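(* There exist sufficiently large universal constants $c$ and $Q$ such that the following holds. Let $K\subseteq\mathbb{R}^n$ be star-shaped, $\sigma>0$, $\varepsilon\in(0,1/Q)$, and define $$\delta^*=\sup\Big\{\delta\ge 0:\ N\frac{\delta^2}{\sigma^2}\le \log M^{\mathrm{loc}}(\delta,c)\Big\}.$$ Assume $N\gtrsim \sup_{\delta>0}\log M^{\mathrm{loc}}(\delta,c)$. Then $\mathfrak{M}_{\mathrm{sym}}\asymp \max(\delta^{*2},\varepsilon^2\sigma^2)\wedge d^2$ if $K$ is bounded with diameter $d$, and $\mathfrak{M}_{\mathrm{sym}}\asymp\max(\delta^{*2},\varepsilon^2\sigma^2)$ if $K$ is unbounded.
   Context: Model: fix integers $n,N\ge1$, $\sigma>0$, contamination level $\varepsilon$. The unknown mean $\mu$ lies in a known set $K\subseteq\mathbb{R}^n$. The uncorrupted sample is $\tilde X_i=\mu+\xi_i$, $i=1,\dots,N$, with $\xi_i$ i.i.d. copies of $\xi$ whose distribution belongs to $\Xi^{\mathrm{sym}}_{\sigma^2}$: the family of (sign-)symmetric distributions ($\xi\overset{d}{=}-\xi$) on $\mathbb{R}^n$ with mean zero and covariance $\Sigma\preceq\sigma^2 I$. An adversary $\mathcal{C}$, which may inspect the whole uncorrupted sample and knows the model and estimator, replaces at most a fraction $\varepsilon$ of the points arbitrarily; one observes $X=\mathcal{C}(\tilde X)$. The minimax risk is $$\mathfrak{M}_{\mathrm{sym}}=\inf_{\hat\mu}\sup_{\mu\in K}\sup_{\xi\in\Xi^{\mathrm{sym}}_{\sigma^2}}\sup_{\mathcal{C}}\mathbb{E}_\mu\|\hat\mu(\mathcal{C}(\tilde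 X))-\mu\|^2.$$ Star-shaped: there is $k^*\in K$ with $(1-t)k^*+tk\in K$ for all $k\in K$, $t\in[0,1]$. Diameter $d=\sup_{x,y\in K}\|x-y\|$. Local metric entropy: $M(\eta,A)$ is the maximal cardinality of a subset of $A$ with pairwise Euclidean distances $>\eta$; $M^{\mathrm{loc}}(\eta,c)=\sup_{\nu\in K}M(\eta/c,\ B(\nu,\eta)\cap K)$. $a\wedge b=\min(a,b)$; $\asymp,\gtrsim$ are up to universal multiplicative constants. *)

(* Defs.v *)
From HB Require Import structures.
From mathcomp Require Import all_boot all_order all_algebra.
From mathcomp Require Import all_classical all_reals all_analysis.
From mathcomp Require Import Rstruct Rstruct_topology.
Set Implicit Arguments. Unset Strict Implicit. Unset Printing Implicit Defensive.
Import Order.TTheory GRing.Theory Num.Theory.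
Local Open Scope classical_set_scope.
Local Open Scope ring_scope.

(* The reals (Stdlib's R, a realType) with the Borel/Lebesgue sigma-algebra, *)
(* and R^n realised as n-tuples of reals with the product sigma-algebra.     *)
Notation RR := Rdefinitions.R.
Notation vec n := (n.-tuple (measurableTypeR RR)).

Definition coord n (x : vec n) (i : 'I_n) : RR := tnth x i.
Definition vadd n (x y : vec n) : vec n :=
  [tuple (coord x i + coord y i : measurableTypeR RR) | i < n].
Definition vopp n (x : vec n) : vec n :=
  [tuple (- coord x i : measurableTypeR RR) | i < n].
Definition vsub n (x y : vec n) : vec n := vadd x (vopp y).
Definition vscale n (a : RR) (x : vec n) : vec n :=
  [tuple (a * coord x i : measurableTypeR RR) | i < n].
Definition sqnorm n (x : vec n) : RR := \sum_(i < n) coord x i ^+ 2.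
Definition dist n (x y : vec n) : RR := Num.sqrt (sqnorm (vsub x y)).

Definition star_shaped n (K : set (vec n)) : Prop :=
  exists2 ks, K ks &
    forall k t, K k -> 0 <= t <= 1 -> K (vadd (vscale (1 - t) ks) (vscale t k)).

Definition diam n (K : set (vec n)) : \bar RR :=
  ereal_sup [set (dist x y)%:E | x in K & y in K].

Definition ball_cl n (nu : vec n) (r : RR) : set (vec n) :=
  [set x | dist x nu <= r].

Definition packing n (eta : RR) (A : set (vec n)) : \bar RR :=
  ereal_sup [set (size s)%:R%:E | s in [set s : seq (vec n) |
     [/\ uniq s, (forall x, x \in s -> A x) &
         (forall x y, x \in s -> y \in s -> x != y -> eta < dist x y)]]].

Definition Mloc n (K : set (vec n)) (eta c : RR) : \bar RR :=
  ereal_sup [set packing (eta / c) (ball_cl nu eta `&` K) | nu in K].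

Definition delta_star n (K : set (vec n)) (N : nat) (sigma c : RR) : \bar RR :=
  ereal_sup [set delta%:E | delta in
     [set delta : RR | 0 <= delta /\
        ((N%:R * delta ^+ 2 / sigma ^+ 2)%:E <= lne (Mloc K delta c))%E]].

Definition sup_log_Mloc n (K : set (vec n)) (c : RR) : \bar RR :=
  ereal_sup [set lne (Mloc K delta c) | delta in [set delta : RR | 0 < delta]].

Section noise.
Local Open Scope ereal_scope.
Context (n : nat).

Definition mean (P : probability (vec n) RR) (i : 'I_n) : RR :=
  fine (\int[P]_x (coord x i)%:E).

Definition covariance (P : probability (vec n) RR) (i j : 'I_n) : RR :=
  fine (\int[P]_x ((coord x i - mean P i) * (coord x j - mean P j))%R%:E).

Definition Xi_sym (sigma : RR) (P : probability (vec n) RR) : Prop :=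
  [/\ (forall A, measurable A -> P (@vopp n @^-1` A) = P A),
      (forall i, P.-integrable setT (fun x => ((coord x i) ^+ 2)%R%:E)),
      (forall i, mean P i = 0%R) &
      (forall v : 'I_n -> RR,
         (0 <= \sum_(i < n) \sum_(j < n)
                 v i * ((if i == j then sigma ^+ 2 else 0) - covariance P i j) * v j)%R)].
End noise.

(* Expectation over an i.i.d. sample of size N from P: the integral of f      *)
(* against the N-fold product measure P^{(x) N}, written as the iterated      *)
(* integral (Tonelli; f is nonnegative).                                     *)
Section iid.
Local Open Scope ereal_scope.
Context {d} {T : measurableType d} (P : probability T RR).
Fixpoint iid_expect (k : nat) : (k.-tuple T -> \bar RR) -> \bar RR :=
  match k return (k.-tuple T -> \bar RR) -> \bar RR with
  | 0 => fun f => f [tuple]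
  | k'.+1 => fun f => \int[P]_x iid_expect (fun t => f (cons_tuple x t))
  end.
End iid.

Definition sample n N := N.-tuple (vec n).

Definition adversary n N (eps : RR) (C : sample n N -> sample n N) : Prop :=
  measurable_fun setT C /\
  forall X : sample n N,
    (#|[set i : 'I_N | tnth (C X) i != tnth X i]|%:R <= eps * N%:R)%R.

Definition estimator n N (muhat : sample n N -> vec n) : Prop :=
  measurable_fun setT muhat.

Definition shift_sample n N (mu : vec n) (xi : sample n N) : sample n N :=
  [tuple vadd mu (tnth xi i) | i < N].

Definition risk n N (P : probability (vec n) RR) (mu : vec n)
    (C : sample n N -> sample n N) (muhat : sample n N -> vec n) : \bar RR :=
  iid_expect P (fun xi => (sqnorm (vsub (muhat (C (shift_sample mu xi))) mu))%:E).

Definition worst_risk n N (K : set (vec n)) (sigma eps : RR)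
    (muhat : sample n N -> vec n) : \bar RR :=
  ereal_sup [set r | exists mu (P : probability (vec n) RR)
                            (C : sample n N -> sample n N),
     [/\ K mu, Xi_sym sigma P, adversary eps C & r = risk P mu C muhat]].

Definition minimax_sym n N (K : set (vec n)) (sigma eps : RR) : \bar RR :=
  ereal_inf [set worst_risk K sigma eps muhat
            | muhat in [set muhat : sample n N -> vec n | estimator muhat]].

(* Main.v *)
Require Import Defs.
From HB Require Import structures.
From mathcomp Require Import all_boot all_order all_algebra.
From mathcomp Require Import all_classical all_reals all_analysis.
From mathcomp Require Import Rstruct Rstruct_topology.
From mathcomp Require Import measurable_realfun.
From mathcomp Require Import ring lra.
Import Order.TTheory GRing.Theory Num.Theory.
Local Open Scope classical_set_scope.
Local Open Scope ring_scope.
Set Implicit Arguments. Unset Strict Implicit. Unset Printing Implicit Defensive.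
Local Notation coord := Defs.coord.
Local Notation covariance := Defs.covariance.
Local Notation mR := (measurableTypeR RR).
Local Notation expRD := exp.expRD.
Local Notation expR0 := exp.expR0.

(** Upper bound. Fix [eta] proportional to max(delta_star, eps * sigma) and a
    maximal [eta / 2]-separated subset G of K. Two points g, h of G at distance d
    are compared through the sum of the clipped projections of the sample on the
    line gh. Clipped symmetric noise is centered, so the contamination shifts
    this sum only by O(eps * N), and an exponential moment bound makes the wrong
    answer have probability at most (1 + c d^2 / sigma^2)^(- c' N), for all d of
    order at least [eta]: Gaussian decay for d <= sigma, polynomial decay of
    order N beyond, which is what makes the risk finite on unbounded K. The
    estimator is the point of G that loses only against close rivals.
    By star-shapedness the local entropy is nonincreasing, so a ball of radius
    2^k [eta] contains at most exp((k + 1) N eta^2 / sigma^2) points of G, and the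
    union bound over dyadic shells converges.

    Lower bound. A packing at scale delta_star with Gaussian noise gives
    delta_star^2, and a two point argument with lattice noise gives
    min(eps^2 sigma^2, diam^2). *)

(** * Euclidean geometry and measurability *)

Section geometry.
Context (n : nat).
Implicit Types (x y z : vec n) (a r : RR).

Definition vzero : vec n := [tuple (0 : measurableTypeR RR) | _ < n].
Definition dot x y : RR := \sum_(i < n) coord x i * coord y i.

Lemma coord_mktuple (f : 'I_n -> RR) i :
  coord [tuple (f i : measurableTypeR RR) | i < n] i = f i.
Proof. exact: tnth_mktuple. Qed.

Lemma coordD x y i : coord (vadd x y) i = coord x i + coord y i.
Proof. exact: coord_mktuple. Qed.
Lemma coordN x i : coord (vopp x) i = - coord x i.
Proof. exact: coord_mktuple. Qed.
Lemma coordB x y i : coord (vsub x y) i = coord x i - coord y i.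
Proof. by rewrite coordD coordN. Qed.
Lemma coordZ a x i : coord (vscale a x) i = a * coord x i.
Proof. exact: coord_mktuple. Qed.
Lemma coord0 i : coord vzero i = 0.
Proof. exact: coord_mktuple. Qed.
Definition coordE := (coordB, coordD, coordN, coordZ, coord0).

Lemma vec_ext x y : (forall i, coord x i = coord y i) -> x = y.
Proof. exact: eq_from_tnth. Qed.

Lemma dotC x y : dot x y = dot y x.
Proof. by apply: eq_bigr => i _; rewrite mulrC. Qed.
Lemma dotDr x y z : dot x (vadd y z) = dot x y + dot x z.
Proof. by rewrite /dot -big_split; apply: eq_bigr => i _; rewrite coordE mulrDr. Qed.
Lemma dotNr x y : dot x (vopp y) = - dot x y.
Proof. by rewrite /dot -sumrN; apply: eq_bigr => i _; rewrite coordE mulrN. Qed.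
Lemma dotBr x y z : dot x (vsub y z) = dot x y - dot x z.
Proof. by rewrite dotDr dotNr. Qed.
Lemma dotZr a x y : dot x (vscale a y) = a * dot x y.
Proof. by rewrite /dot mulr_sumr; apply: eq_bigr => i _; rewrite coordE mulrCA. Qed.
Lemma dotDl x y z : dot (vadd y z) x = dot y x + dot z x.
Proof. by rewrite dotC dotDr !(dotC x). Qed.
Lemma dotNl x y : dot (vopp y) x = - dot y x.
Proof. by rewrite dotC dotNr dotC. Qed.
Lemma dotBl x y z : dot (vsub y z) x = dot y x - dot z x.
Proof. by rewrite dotDl dotNl. Qed.
Lemma dotZl a x y : dot (vscale a y) x = a * dot y x.
Proof. by rewrite dotC dotZr dotC. Qed.
Definition dotE := (dotBr, dotBl, dotDr, dotDl, dotNr, dotNl, dotZr, dotZl).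

Lemma sqnormE x : sqnorm x = dot x x.
Proof. by apply: eq_bigr => i _; rewrite expr2. Qed.
Lemma sqnorm_ge0 x : 0 <= sqnorm x.
Proof. by apply: sumr_ge0 => i _; exact: sqr_ge0. Qed.
Lemma sqnorm_eq0 x : sqnorm x = 0 -> x = vzero.
Proof.
move/psumr_eq0P => x0; apply: vec_ext => i; rewrite coord0.
by apply/eqP; rewrite -sqrf_eq0; apply/eqP/x0 => // j _; exact: sqr_ge0.
Qed.

Lemma sqnorm0 : sqnorm vzero = 0.
Proof. by rewrite /sqnorm big1// => i _; rewrite coord0 expr0n. Qed.

Lemma cauchy_schwarz x y : dot x y ^+ 2 <= sqnorm x * sqnorm y.
Proof.
have [y0|y0] := eqVneq (sqnorm y) 0.
  have -> : y = vzero by exact: sqnorm_eq0.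
  rewrite /dot big1 ?expr0n ?mulr_ge0 ?sqnorm_ge0//= => i _.
  by rewrite coord0 mulr0.
have y_gt0 : 0 < sqnorm y by rewrite lt_neqAle eq_sym y0 sqnorm_ge0.
have := sqnorm_ge0 (vsub (vscale (sqnorm y) x) (vscale (dot x y) y)).
rewrite sqnormE !dotE -!sqnormE (dotC y x) => h.
have : 0 <= sqnorm y * (sqnorm x * sqnorm y - dot x y ^+ 2) by lra.
by rewrite pmulr_rge0// subr_ge0.
Qed.

Lemma dist_ge0 x y : 0 <= dist x y. Proof. exact: sqrtr_ge0. Qed.
Lemma sqr_dist x y : dist x y ^+ 2 = sqnorm (vsub x y).
Proof. by rewrite sqr_sqrtr// sqnorm_ge0. Qed.
Lemma sqnormN x : sqnorm (vopp x) = sqnorm x.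
Proof. by rewrite !sqnormE !dotE opprK. Qed.
Lemma sqnormZ a x : sqnorm (vscale a x) = a ^+ 2 * sqnorm x.
Proof. by rewrite !sqnormE !dotE mulrA expr2. Qed.
Lemma vsubC x y : vsub x y = vopp (vsub y x).
Proof. by apply: vec_ext => i; rewrite !coordE opprB. Qed.
Lemma dist_sym x y : dist x y = dist y x.
Proof. by rewrite /dist vsubC sqnormN. Qed.
Lemma distxx x : dist x x = 0.
Proof.
rewrite /dist /sqnorm big1 ?sqrtr0// => i _.
by rewrite coordE subrr expr0n.
Qed.
Lemma le_dist_sqnorm x y r : 0 <= r -> (dist x y <= r) = (sqnorm (vsub x y) <= r ^+ 2).
Proof. by move=> r0; rewrite -sqr_dist ler_pXn2r// nnegrE dist_ge0. Qed.

Lemma dot_le_dist x y z t : `|dot (vsub x y) (vsub z t)| <= dist x y * dist z t.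
Proof.
rewrite -ler_sqr ?nnegrE ?mulr_ge0 ?dist_ge0// real_normK ?num_real//.
by rewrite exprMn !sqr_dist cauchy_schwarz.
Qed.

Lemma dist_triangle y x z : dist x z <= dist x y + dist y z.
Proof.
rewrite le_dist_sqnorm ?addr_ge0 ?dist_ge0//.
have -> : vsub x z = vadd (vsub x y) (vsub y z).
  by apply: vec_ext => i; rewrite !coordE; ring.
rewrite sqrrD !sqr_dist.
have := dot_le_dist x y y z; move: (vsub x y) (vsub y z) => u v uv.
rewrite sqnormE !dotE -!sqnormE (dotC v u).
by have := ler_normlW uv; lra.
Qed.

Lemma dist_scale_center a z x y :
  dist (vadd (vscale (1 - a) z) (vscale a x)) (vadd (vscale (1 - a) z) (vscale a y))
  = `|a| * dist x y.
Proof.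
rewrite /dist.
have -> : vsub (vadd (vscale (1 - a) z) (vscale a x)) (vadd (vscale (1 - a) z) (vscale a y))
   = vscale a (vsub x y) by apply: vec_ext => i; rewrite !coordE; ring.
by rewrite sqnormZ sqrtrM ?sqr_ge0// sqrtr_sqr.
Qed.

End geometry.

Section vec_measurability.
Context {d} {T : measurableType d} (n : nat).
Implicit Types (f g : T -> vec n).

Lemma measurable_vecP f :
  measurable_fun setT f <-> forall i, measurable_fun setT (fun t => coord (f t) i : mR).
Proof. exact: measurable_fun_tnthP. Qed.

Lemma measurable_coord f i :
  measurable_fun setT f -> measurable_fun setT (fun t => coord (f t) i : mR).
Proof. by move/measurable_vecP. Qed.

Lemma measurable_vadd f g : measurable_fun setT f -> measurable_fun setT g ->
  measurable_fun setT (fun t => vadd (f t) (g t)).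
Proof.
move=> mf mg; apply/measurable_vecP => i; under eq_fun do rewrite coordD.
by apply: measurable_funD; exact: measurable_coord.
Qed.

Lemma measurable_vopp f : measurable_fun setT f ->
  measurable_fun setT (fun t => vopp (f t)).
Proof.
move=> mf; apply/measurable_vecP => i; under eq_fun do rewrite coordN.
by apply: measurableT_comp => //; exact: measurable_coord.
Qed.

Lemma measurable_vsub f g : measurable_fun setT f -> measurable_fun setT g ->
  measurable_fun setT (fun t => vsub (f t) (g t)).
Proof. by move=> mf mg; apply: measurable_vadd => //; exact: measurable_vopp. Qed.

Lemma measurable_dot f g : measurable_fun setT f -> measurable_fun setT g ->
  measurable_fun setT (fun t => dot (f t) (g t) : mR).
Proof.
move=> mf mg; apply: measurable_sum => i.
by apply: measurable_funM; exact: measurable_coord.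
Qed.

Lemma measurable_sqnorm f : measurable_fun setT f ->
  measurable_fun setT (fun t => sqnorm (f t) : mR).
Proof.
by move=> mf; under eq_fun do rewrite sqnormE; exact: measurable_dot.
Qed.

Lemma measurable_dist f g : measurable_fun setT f -> measurable_fun setT g ->
  measurable_fun setT (fun t => dist (f t) (g t) : mR).
Proof.
move=> mf mg; rewrite /dist.
apply: (@measurableT_comp _ _ _ _ _ _ (@Num.sqrt RR : mR -> mR)).
  by apply: continuous_measurable_fun; exact: sqrt_continuous.
by apply: measurable_sqnorm; exact: measurable_vsub.
Qed.

Lemma measurable_expRf (h : T -> mR) : measurable_fun setT h ->
  measurable_fun setT (fun t => expR (h t) : mR).
Proof.
move=> mh; apply: (@measurableT_comp _ _ _ T mR mR expR setT h _ mh).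
exact: measurable_expR.
Qed.

End vec_measurability.

Lemma measurable_vec1 n (x : vec n) : measurable [set x].
Proof.
have -> : [set x] = \bigcap_(i in setT) (if insub i is Some j then
   (fun y : vec n => coord y j) @^-1` [set coord x j] else setT).
  apply/seteqP; split=> [y -> i _|y h]; first by case: insubP.
  apply: vec_ext => i; have := h i I; rewrite valK//.
apply: bigcap_measurable => // i _; case: insubP => // j _ _.
by rewrite -[X in measurable X]setTI; exact: measurable_tnth.
Qed.

(** * Product measures *)

Section iid_expectation.
Local Open Scope ereal_scope.
Context {d} {T : measurableType d} (P : probability T RR).

Lemma pushforward_probability_ex {d'} {T' : measurableType d'} (phi : T -> T') :
  measurable_fun setT phi ->
  exists Q : probability T' RR, forall f : T' -> \bar RR, measurable_fun setT f ->
    (forall x, 0 <= f x) -> \int[Q]_x f x = \int[P]_x f (phi x).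
Proof.
move=> mphi; pose X : {mfun T >-> T'} :=
  HB.pack phi (isMeasurableFun.Build _ _ _ _ phi mphi).
by exists (distribution P X) => f mf f0; rewrite ge0_integral_distribution.
Qed.
End iid_expectation.

Lemma integral_probability_cst {d} {T : measurableType d} (P : probability T RR)
  (c : \bar RR) : (\int[P]_x c = c)%E.
Proof.
by rewrite integral_cst// [X in (_ * X)%E](_ : _ = 1%E) ?mule1//; exact: probability_setT.
Qed.

Section iid_product.
Local Open Scope ereal_scope.
Context {d} {T : measurableType d} (P : probability T RR).

Lemma measurable_cons_tuple k :
  measurable_fun setT (fun p : T * k.-tuple T => cons_tuple p.1 p.2).
Proof. by apply: measurable_cons. Qed.

Lemma iid_expect_probability k : exists Q : probability (k.-tuple T) RR,
  forall f : k.-tuple T -> \bar RR, measurable_fun setT f ->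
    (forall x, 0 <= f x) -> iid_expect P f = \int[Q]_x f x.
Proof.
elim: k => [|k [Q IH]].
  exists (dirac [tuple]) => f mf f0 /=.
  by rewrite integral_dirac// diracT mul1e.
have [Q' Q'E] := pushforward_probability_ex (P \x Q) (@measurable_cons_tuple k).
exists Q' => f mf f0; rewrite Q'E//=.
have mfc : measurable_fun setT (fun p : T * k.-tuple T => f (cons_tuple p.1 p.2)).
  by apply: measurableT_comp => //; exact: measurable_cons_tuple.
rewrite fubini_tonelli1//; apply: eq_integral => x _.
by rewrite /fubini_F/= IH//; exact: (measurableT_comp mfc (pair1_measurable x)).
Qed.

Lemma iid_expect_ge0 k (f : k.-tuple T -> \bar RR) :
  (forall x, 0 <= f x) -> 0 <= iid_expect P f.
Proof.
by elim: k f => [|k IH] f f0 //=; apply: integral_ge0 => x _; exact: IH.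
Qed.

Lemma eq_iid_expect k (f g : k.-tuple T -> \bar RR) :
  f =1 g -> iid_expect P f = iid_expect P g.
Proof. by move=> /funext ->. Qed.

Lemma measurable_iid_expect {d'} {S : measurableType d'} k
    (f : S * k.-tuple T -> \bar RR) :
  measurable_fun setT f -> (forall x, 0 <= f x) ->
  measurable_fun setT (fun s => iid_expect P (fun t => f (s, t))).
Proof.
move=> mf f0; have [Q QE] := iid_expect_probability k.
rewrite (_ : (fun _ => _) = fubini_F Q f).
  exact: measurable_fun_fubini_tonelli_F.
by apply/funext => s; rewrite QE//; exact: (measurableT_comp mf (pair1_measurable s)).
Qed.

Lemma measurable_comp_cons k {d'} {S : measurableType d'} (f : k.+1.-tuple T -> S) x :
  measurable_fun setT f -> measurable_fun setT (fun t => f (cons_tuple x t)).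
Proof. by move=> mf; apply: measurableT_comp => //; apply: measurable_cons. Qed.

Lemma le_iid_expect k (f g : k.-tuple T -> \bar RR) :
  measurable_fun setT f -> measurable_fun setT g ->
  (forall x, 0 <= f x) -> (forall x, f x <= g x) ->
  iid_expect P f <= iid_expect P g.
Proof.
move=> mf mg f0 fg; have [Q QE] := iid_expect_probability k.
rewrite !QE//; first by apply: ge0_le_integral => // x _; exact: le_trans (fg x).
by move=> x; exact: le_trans (fg x).
Qed.

Lemma iid_expect_cst k (c : RR) : (0 <= c)%R ->
  iid_expect P (fun _ : k.-tuple T => c%:E) = c%:E.
Proof.
move=> c0; elim: k => [//|k IH] /=; under eq_integral do rewrite IH.
exact: integral_probability_cst.
Qed.

Lemma iid_expect_tnth k (i : 'I_k) (f : T -> \bar RR) :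
  measurable_fun setT f -> (forall x, 0 <= f x) ->
  iid_expect P (fun t : k.-tuple T => f (tnth t i)) = \int[P]_x f x.
Proof.
move=> mf f0; elim: k i => [[]//|k IH] i /=.
have [->|i0] := eqVneq i ord0.
  apply: eq_integral => x _ /=; under eq_iid_expect do rewrite tnth0.
  have [Q QE] := iid_expect_probability k.
  by rewrite QE// integral_probability_cst.
have [j ->] : exists j, i = lift ord0 j.
  by case: (unliftP ord0 i) i0 => [j ->|->]; [exists j|rewrite eqxx].
under eq_integral do (under eq_iid_expect do rewrite tnthS; rewrite IH).
exact: integral_probability_cst.
Qed.

(* Iterated form of a change of measure [E f(tau x) = E (f(x) l(x))]; the i-th
   coordinate has its own map [tau i] and its own likelihood ratio [l i]. *)
Lemma iid_expect_change k (tau : 'I_k -> T -> T) (l : 'I_k -> T -> RR)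
    (F : k.-tuple T -> \bar RR) :
  (forall i, measurable_fun setT (tau i)) ->
  (forall i, measurable_fun setT (l i : T -> mR)) ->
  (forall i x, (0 <= l i x)%R) ->
  (forall i f, measurable_fun setT f -> (forall x, 0 <= f x) ->
     \int[P]_x f (tau i x) = \int[P]_x (f x * (l i x)%:E)) ->
  measurable_fun setT F -> (forall x, 0 <= F x) ->
  iid_expect P (fun t => F [tuple tau i (tnth t i) | i < k]) =
  iid_expect P (fun t => F t * (\prod_(i < k) l i (tnth t i))%:E).
Proof.
elim: k tau l F => [|k IH] tau l F mtau ml l0 tauP mF F0 /=.
  by rewrite big_ord0 mule1; congr F; exact: tuple0.
have mFx x : measurable_fun setT (fun t => F (cons_tuple x t)).
  exact: measurable_comp_cons.
transitivity (\int[P]_x iid_expect P (fun t : k.-tuple T => F (cons_tuple (tau ord0 x)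
    [tuple tau (lift ord0 i) (tnth t i) | i < k]))).
  apply: eq_integral => x _; apply: eq_iid_expect => t; congr F.
  apply: eq_from_tnth => i; rewrite tnth_mktuple.
  case: (unliftP ord0 i) => [j ->|->]; last by rewrite !tnth0.
  by rewrite !tnthS tnth_mktuple.
have mlt : measurable_fun setT (fun t : k.-tuple T =>
    (\prod_(i < k) l (lift ord0 i) (tnth t i))%R : mR).
  apply: measurable_prod => i _.
  exact: (measurableT_comp (ml (lift ord0 i)) (measurable_tnth i)).
pose G x := iid_expect P (fun t => F (cons_tuple x t) *
  (\prod_(i < k) l (lift ord0 i) (tnth t i))%:E).
have mG0 : measurable_fun setT (fun p : T * k.-tuple T => F (cons_tuple p.1 p.2) *
  (\prod_(i < k) l (lift ord0 i) (tnth p.2 i))%:E).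
  apply: emeasurable_funM.
    by apply: measurableT_comp => //; exact: measurable_cons_tuple.
  apply/measurable_EFinP.
  exact: (measurableT_comp mlt).
have mG : measurable_fun setT G.
  apply: (measurable_iid_expect mG0) => x.
  by rewrite mule_ge0// lee_fin prodr_ge0.
have G0 x : 0 <= G x.
  by apply: iid_expect_ge0 => t; rewrite mule_ge0// lee_fin prodr_ge0.
transitivity (\int[P]_x G (tau ord0 x)).
  apply: eq_integral => x _; rewrite (IH (fun i => tau (lift ord0 i))
    (fun i => l (lift ord0 i)) (fun t => F (cons_tuple (tau ord0 x) t)))//.
  by move=> i; exact: tauP.
rewrite (tauP ord0 G)//; apply: eq_integral => x _.
have [Q QE] := iid_expect_probability k.
have mFl : measurable_fun setT (fun t : k.-tuple T => F (cons_tuple x t) *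
      (\prod_(i < k) l (lift ord0 i) (tnth t i))%:E).
  by apply: emeasurable_funM => //; exact/measurable_EFinP.
rewrite /G QE//; last by move=> t; rewrite mule_ge0// lee_fin prodr_ge0.
rewrite muleC -ge0_integralZl_EFin//; last first.
  by move=> t _; rewrite mule_ge0// lee_fin prodr_ge0.
rewrite -QE//.
- apply: eq_iid_expect => t; rewrite muleCA -EFinM big_ord_recl tnth0.
  by under [in RHS]eq_bigr do rewrite tnthS.
- by apply: emeasurable_funM => //.
- by move=> t; rewrite !mule_ge0 ?lee_fin ?prodr_ge0.
Qed.

Lemma iid_expect_prod_le k (g : T -> RR) (b : RR) :
  measurable_fun setT (g : T -> mR) -> (forall x, (0 <= g x)%R) ->
  \int[P]_x (g x)%:E <= b%:E ->
  iid_expect P (fun t : k.-tuple T => (\prod_(i < k) g (tnth t i))%:E) <= (b ^+ k)%:E.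
Proof.
move=> mg g0 gb.
have b0 : (0 <= b)%R.
  by rewrite -lee_fin (le_trans _ gb)// integral_ge0// => x _; rewrite lee_fin.
have mp j : measurable_fun setT (fun t : j.-tuple T =>
    (\prod_(i < j) g (tnth t i))%R : mR).
  apply: measurable_prod => i _.
  exact: (measurableT_comp mg (measurable_tnth i)).
elim: k => [|k IH] /=; first by rewrite big_ord0.
have [Q QE] := iid_expect_probability k.
have E x : iid_expect P (fun t : k.-tuple T =>
    (\prod_(i < k.+1) g (tnth (cons_tuple x t) i))%:E) =
  (g x)%:E * \int[Q]_t (\prod_(i < k) g (tnth t i))%:E.
  rewrite -ge0_integralZl_EFin//; first last.
  - by apply/measurable_EFinP; exact: mp.
  - by move=> t _; rewrite lee_fin prodr_ge0.
  rewrite -QE; first last.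
  - by move=> t; rewrite mule_ge0 ?lee_fin ?prodr_ge0.
  - by apply: measurable_funeM; apply/measurable_EFinP; exact: mp.
  - apply: eq_iid_expect => t; rewrite big_ord_recl tnth0 EFinM.
    by under [in LHS]eq_bigr do rewrite tnthS.
under eq_integral do rewrite E muleC.
rewrite -QE; last 2 first.
- by apply/measurable_EFinP; exact: mp.
- by move=> t; rewrite lee_fin prodr_ge0.
rewrite ge0_integralZl//; last 3 first.
- by apply/measurable_EFinP.
- by move=> x _; rewrite lee_fin.
- by apply: iid_expect_ge0 => t; rewrite lee_fin prodr_ge0.
rewrite exprSr EFinM lee_pmul//.
- by apply: iid_expect_ge0 => t; rewrite lee_fin prodr_ge0.
- by rewrite integral_ge0// => x _; rewrite lee_fin.
Qed.

End iid_product.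

(** * Packings and local entropy *)

Section separated_sequences.
Context (n : nat).
Implicit Types (x y nu : vec n) (s t : seq (vec n)) (K : set (vec n)).

Definition separated (r : RR) s :=
  forall x y, x \in s -> y \in s -> x != y -> r < dist x y.

Lemma separated_sub r s t : {subset t <= s} -> separated r s -> separated r t.
Proof. by move=> ts sr x y xt yt; apply: sr; exact: ts. Qed.

Lemma separated_net r s : exists t,
  [/\ uniq t, {subset t <= s}, separated r t &
      forall x, x \in s -> exists2 y, y \in t & dist x y <= r \/ x = y].
Proof.
elim: s => [|a s [t [ut ts sept cov]]]; first by exists [::].
have [[y yt ya]|na] := pselect (exists2 y, y \in t & dist a y <= r).
  exists t; split=> // [x /ts xs|x]; first by rewrite inE xs orbT.
  by rewrite inE => /predU1P[->|/cov//]; exists y => //; left.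
have na' y : y \in t -> r < dist a y.
  by move=> yt; rewrite ltNge; apply/negP => ya; apply: na; exists y.
have [at_|at_] := boolP (a \in t).
  exists t; split=> // [x /ts xs|x]; first by rewrite inE xs orbT.
  by rewrite inE => /predU1P[->|/cov//]; exists a => //; right.
exists (a :: t); split.
- by rewrite /= at_.
- by move=> x; rewrite !inE => /orP[->//|/ts ->]; rewrite orbT.
- move=> x y; rewrite !inE => /predU1P[->|xt] /predU1P[->|yt].
  + by rewrite eqxx.
  + by move=> _; exact: na'.
  + by move=> _; rewrite dist_sym; exact: na'.
  + exact: sept.
- move=> x; rewrite inE => /predU1P[->|/cov[y yt h]].
    by exists a; rewrite ?inE ?eqxx//; right.
  by exists y => //; rewrite inE yt orbT.
Qed.

Lemma size_le_sum_count (S1 S2 : eqType) (P : S1 -> S2 -> bool)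
    (u : seq S1) (v : seq S2) :
  (forall a, a \in u -> has (P a) v) ->
  (size u <= \sum_(b <- v) count (P^~ b) u)%N.
Proof.
elim: u => [|a u IH] h //=.
rewrite big_split/= -add1n leq_add//.
  rewrite (leq_trans (_ : 1 <= count (P a) v)%N)//.
    by rewrite -has_count h// inE eqxx.
  by rewrite -sum1_count [X in (X <= _)%N]big_mkcond/=; apply: leq_sum => b _; case: (P a b).
by apply: IH => b bu; rewrite h// inE bu orbT.
Qed.

(* Iterating a covering of balls by balls of half the radius turns a bound on
   the local packing numbers into one on packings of large balls. *)
Lemma separated_ball_size K (eta L : RR) : 0 < eta ->
  (forall eta' nu s, eta <= eta' -> K nu -> uniq s ->
     (forall x, x \in s -> K x /\ dist x nu <= eta') ->
     separated (eta' / 2) s -> (size s)%:R <= L) ->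
  forall k nu s, K nu -> uniq s ->
    (forall x, x \in s -> K x /\ dist x nu <= eta * 2 ^+ k) ->
    separated (eta / 2) s -> (size s)%:R <= L ^+ k.+1.
Proof.
move=> eta0 H; elim=> [|k IH] nu s Knu us sK sep.
  by rewrite expr1; apply: (H eta nu s) => // x /sK; rewrite expr0 mulr1.
have [t [ut ts sept cov]] := separated_net (eta * 2 ^+ k.+1 / 2) s.
have halfE : eta * 2 ^+ k.+1 / 2 = eta * 2 ^+ k.
  by rewrite exprSr mulrA mulfK.
have L0 : 0 <= L by apply: le_trans (H eta nu [::] _ _ _ _ _) => //.
have tL : (size t)%:R <= L.
  apply: (H (eta * 2 ^+ k.+1) nu t) => //; last by move=> x /ts /sK.
  by rewrite ler_peMr ?(ltW eta0)// exprn_ege1// ler1n.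
pose P x y := dist x y <= eta * 2 ^+ k.
have hP x : x \in s -> has (P x) t.
  move=> /cov[y yt]; rewrite halfE => xy; apply/hasP; exists y => //.
  case: xy => [//|->]; rewrite /P distxx.
  by rewrite mulr_ge0 ?(ltW eta0)// exprn_ge0.
have := size_le_sum_count hP; rewrite -(ler_nat RR) natr_sum => /le_trans; apply.
apply: (@le_trans _ _ (\sum_(y <- t) L ^+ k.+1)).
  rewrite !big_seq; apply: ler_sum => y yt.
  rewrite -size_filter; apply: (IH y) => //.
  - by have [] := sK _ (ts _ yt).
  - exact: filter_uniq.
  - by move=> x; rewrite mem_filter => /andP[Pxy /sK[]].
  - by apply: separated_sub sep => x; rewrite mem_filter => /andP[].
rewrite big_const_seq count_predT iter_addr_0 -[X in X <= _]mulr_natl.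
by rewrite [leRHS]exprS ler_wpM2r ?exprn_ge0.
Qed.

Lemma vsub_segment a x y : vsub (vadd (vscale (1 - a) x) (vscale a y)) x = vscale a (vsub y x).
Proof. by apply: vec_ext => i; rewrite !coordE; ring. Qed.

Lemma dist_segment a x y : 0 <= a ->
  dist (vadd (vscale (1 - a) x) (vscale a y)) x = a * dist y x.
Proof.
by move=> a0; rewrite /dist vsub_segment sqnormZ sqrtrM ?sqr_ge0// sqrtr_sqr ger0_norm.
Qed.

End separated_sequences.

Section local_entropy.
Context (n : nat) (K : set (vec n)).
Implicit Types (x y nu : vec n) (s t : seq (vec n)).

Lemma le_Mloc eta c nu s : K nu -> uniq s ->
  (forall x, x \in s -> K x /\ dist x nu <= eta) -> separated (eta / c) s ->
  ((size s)%:R%:E <= Mloc K eta c)%E.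
Proof.
move=> Knu us sK sep; apply: le_ereal_sup_tmp.
exists (packing (eta / c) (ball_cl nu eta `&` K)); first by exists nu.
apply: le_ereal_sup_tmp; exists (size s)%:R%:E => //; exists s => //; split=> //.
by move=> x /sK[Kx xnu]; split.
Qed.

Lemma lt_Mloc_ex eta c (r : RR) : (r%:E < Mloc K eta c)%E ->
  exists nu s, [/\ K nu, uniq s, (forall x, x \in s -> K x /\ dist x nu <= eta),
    separated (eta / c) s & r < (size s)%:R].
Proof.
move=> /ereal_sup_gt[_ [nu Knu <-]] /ereal_sup_gt[_ [s [us sK sep] <-]].
by rewrite lte_fin => rs; exists nu, s; split=> // x /sK[].
Qed.

Lemma Mloc_ge1 eta c : K !=set0 -> 0 <= eta -> (1 <= Mloc K eta c)%E.
Proof.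
move=> [nu Knu] eta0; apply: (@le_Mloc eta c nu [:: nu]) => //.
  by move=> x; rewrite inE => /eqP ->; rewrite distxx.
by move=> x y; rewrite !inE => /eqP-> /eqP->; rewrite eqxx.
Qed.

Lemma star_Mloc_nincr eta eta' c : star_shaped K -> 0 < c -> 0 < eta -> eta <= eta' ->
  (Mloc K eta' c <= Mloc K eta c)%E.
Proof.
move=> [ks Kks star] c0 eta0 ee'; apply/ereal_supP => _ [nu Knu <-].
apply/ereal_supP => _ [s [us sK sep] <-].
have eta'0 : 0 < eta' by exact: lt_le_trans ee'.
pose a := eta / eta'; have a0 : 0 < a by rewrite divr_gt0.
have a01 : 0 <= a <= 1 by rewrite (ltW a0)/= ler_pdivrMr ?mul1r.
pose f x := vadd (vscale (1 - a) ks) (vscale a x).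
have fE x y : dist (f x) (f y) = a * dist x y.
  by rewrite dist_scale_center gtr0_norm.
have fsep x y : x \in s -> y \in s -> x != y -> eta / c < dist (f x) (f y).
  move=> xs ys xy; rewrite fE.
  rewrite (_ : eta / c = a * (eta' / c)); first by rewrite ltr_pM2l// sep.
  by rewrite /a mulrA divfK// gt_eqF.
have -> : size s = size (map f s) by rewrite size_map.
apply: (le_Mloc (nu := f nu)).
- exact: star.
- rewrite map_inj_in_uniq// => x y xs ys fxy; apply/eqP/negP => /negP xy.
  by have := fsep _ _ xs ys xy; rewrite fxy distxx ltNge divr_ge0 ?ltW.
- move=> _ /mapP[x xs ->]; have [xnu Kx] := sK _ xs; split; first exact: star.
  rewrite fE (_ : eta = a * eta'); first by rewrite ler_pM2l.
  by rewrite /a divfK// gt_eqF.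
- move=> _ _ /mapP[x xs ->] /mapP[y ys ->] fxy; apply: fsep => //.
  by apply: contraNneq fxy => ->.
Qed.

Lemma Mloc_ge2 eta c x y : 1 < c -> 0 < eta -> K x -> K y -> dist x y = eta ->
  (2%:R%:E <= Mloc K eta c)%E.
Proof.
move=> c1 eta0 Kx Ky xy; have c0 : 0 < c by rewrite (lt_trans _ c1).
have xDy : x != y by apply/eqP => xyE; move: eta0; rewrite -xy xyE distxx ltxx.
have lec : eta / c < eta by rewrite ltr_pdivrMr// ltr_pMr.
apply: (@le_Mloc eta c x [:: x; y]) => //.
- by rewrite /= inE xDy.
- move=> z; rewrite !inE => /orP[]/eqP->; first by rewrite distxx ltW.
  by rewrite dist_sym xy.
- move=> z t; rewrite !inE => /orP[]/eqP-> /orP[]/eqP->; rewrite ?eqxx ?xy//.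
  by rewrite dist_sym xy.
Qed.

End local_entropy.

(** * The clipped test *)

Section clipping.
Implicit Types (x y a b l e : RR).

Definition clip y : RR := Num.max (-1) (Num.min y 1).

Lemma clip_bounded y : -1 <= clip y <= 1.
Proof. by rewrite /clip le_max lexx/= ge_max ge_min lexx orbT andbT; lra. Qed.

Lemma clip_id y : -1 <= y <= 1 -> clip y = y.
Proof.
by move=> /andP[y1 y2]; rewrite /clip (min_idPl y2) (max_idPr y1).
Qed.

Lemma clip_low y : y <= -1 -> clip y = -1.
Proof. by move=> y1; rewrite /clip min_l ?max_l//; lra. Qed.

Lemma clip_homo : {homo clip : x y / x <= y}.
Proof.
move=> x y xy; rewrite /clip ge_max le_max lexx/= le_max; apply/orP.
case: (leP (-1) (Num.min x 1)) => h; [right|left; lra].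
by rewrite le_min !ge_min xy lexx orbT.
Qed.

Lemma clip_high y : 1 <= y -> clip y = 1.
Proof. by move=> y1; rewrite /clip min_r ?max_r//; lra. Qed.

Lemma clipN y : clip (- y) = - clip y.
Proof.
case: (leP y (-1)) => y1; first by rewrite (@clip_low y)// clip_high ?opprK//; lra.
case: (leP 1 y) => y2; first by rewrite (@clip_high y)// clip_low//; lra.
by rewrite !clip_id//; lra.
Qed.

Lemma measurable_clip : measurable_fun setT (clip : mR -> mR).
Proof.
apply: measurable_maxr => //.
by apply: measurable_minr => //.
Qed.

Lemma expR_le_quad x : x <= 1 / 2 -> expR x <= 1 + x + 2 * x ^+ 2.
Proof.
move=> x2; have := expR_ge1Dx (- x); rewrite expRN => h.
have e0 := expR_gt0 x.
have h2 : (1 - x) * expR x <= 1.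
  by rewrite (le_trans (ler_wpM2r (ltW e0) h))// mulVf// gt_eqF.
have x1 : 0 < 1 - x by lra.
rewrite -(ler_pM2l x1); apply: (le_trans h2).
rewrite -subr_ge0 (_ : _ - 1 = x ^+ 2 * (1 - 2 * x)); last by ring.
by rewrite mulr_ge0 ?sqr_ge0//; lra.
Qed.

Lemma expR_cosh_le x : - (1 / 2) <= x <= 1 / 2 -> expR x + expR (- x) <= 2 + 4 * x ^+ 2.
Proof.
move=> /andP[x1 x2]; have := expR_le_quad x2.
by have := @expR_le_quad (- x); rewrite sqrrN => /(_ ltac:(lra)); lra.
Qed.

Lemma clip_mgf_small a x : 0 <= a <= 1 / 2 ->
  (expR (a / 2 * clip (x - a)) + expR (a / 2 * clip (- x - a))) / 2 <=
  1 - a ^+ 2 / 4 + 3 * a ^+ 2 * x ^+ 2.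
Proof.
move=> /andP[a0 a2]; have aa : 0 <= a ^+ 2 by exact: sqr_ge0.
have aa4 : a ^+ 2 <= 1 / 4 by rewrite expr2; nra.
case: (leP `|x| (1 / 2)) => [|x2].
  rewrite ler_norml => /andP[x1 x2].
  rewrite !clip_id; try lra.
  rewrite (_ : a / 2 * (x - a) = - (a ^+ 2 / 2) + a / 2 * x); last by field.
  rewrite (_ : a / 2 * (- x - a) = - (a ^+ 2 / 2) + - (a / 2 * x)); last by field.
  rewrite !expRD -mulrDr -mulrA.
  have h1 : expR (- (a ^+ 2 / 2)) <= 1 - a ^+ 2 / 4.
    apply: (le_trans (@expR_le_quad _ _)); first lra.
    rewrite sqrrN; set t := a ^+ 2 in aa aa4 *; nra.
  have xx : x ^+ 2 <= 1 / 4 by rewrite expr2; nra.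
  have ax : - (1 / 2) <= a / 2 * x <= 1 / 2 by apply/andP; split; nra.
  have := expR_cosh_le ax; rewrite exprMn expr_div_n => h2.
  have xx0 : 0 <= x ^+ 2 by exact: sqr_ge0.
  have h3 : (expR (a / 2 * x) + expR (- (a / 2 * x))) / 2 <= 1 + a ^+ 2 / 2 * x ^+ 2.
    by move: h2; set A := a ^+ 2; set X := x ^+ 2; lra.
  apply: (le_trans (ler_pM _ _ h1 h3)).
  - exact: expR_ge0.
  - by rewrite divr_ge0// addr_ge0 ?expR_ge0.
  - by set A := a ^+ 2 in aa aa4 *; set X := x ^+ 2 in xx xx0 *; nra.
have xx : 1 / 4 <= x ^+ 2.
  by rewrite -real_normK ?num_real// expr2; nra.
set p := clip (x - a).
have pq : clip (- x - a) <= - p.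
  by rewrite -clipN; apply: clip_homo; lra.
have pb := clip_bounded (x - a); rewrite -/p in pb.
have h1 : expR (a / 2 * clip (- x - a)) <= expR (- (a / 2 * p)).
  by rewrite ler_expR -mulrN ler_wpM2l//; lra.
have pp : p ^+ 2 <= 1 by rewrite expr2; nra.
have ap : - (1 / 2) <= a / 2 * p <= 1 / 2 by apply/andP; split; nra.
have := expR_cosh_le ap; rewrite exprMn expr_div_n => h2.
have pp0 : 0 <= p ^+ 2 by exact: sqr_ge0.
apply: (@le_trans _ _ (1 + a ^+ 2 / 2)).
  by set A := a ^+ 2 in aa aa4 h2 *; set X := p ^+ 2 in pp pp0 h2 *; nra.
by set A := a ^+ 2 in aa aa4 *; set X := x ^+ 2 in xx *; nra.
Qed.

Lemma clip_mgf_large a x : 3 <= a ->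
  (expR (ln a * clip (x - a)) + expR (ln a * clip (- x - a))) / 2 <=
  a^-1 + 9 / (4 * a) * x ^+ 2.
Proof.
move=> a3; have a0 : 0 < a by lra.
have la : 0 <= ln a by rewrite ln_ge0//; lra.
have ub y : expR (ln a * clip y) <= a.
  rewrite -[leRHS](lnK (x := a)) ?posrE// ler_expR.
  by have := clip_bounded y => /andP[_ h]; rewrite -[leRHS]mulr1 ler_wpM2l.
have ia : 0 < a^-1 by rewrite invr_gt0.
have xx0 : 0 <= x ^+ 2 by exact: sqr_ge0.
case: (leP `|x| (a - 1)) => [|x2].
  rewrite ler_norml => /andP[x1 x2].
  rewrite !clip_low; try lra.
  rewrite mulrN1 expRN lnK ?posrE//.
  have : 0 <= 9 / (4 * a) * x ^+ 2 by rewrite mulr_ge0// divr_ge0//; lra.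
  lra.
have xx : (2 * a / 3) ^+ 2 <= x ^+ 2.
  rewrite -[x ^+ 2]real_normK ?num_real// ler_pXn2r// ?nnegrE; lra.
have h : a <= 9 / (4 * a) * x ^+ 2.
  apply: (@le_trans _ _ (9 / (4 * a) * (2 * a / 3) ^+ 2)); last first.
    by rewrite ler_pM2l// divr_gt0//; lra.
  by rewrite le_eqVlt; apply/orP; left; apply/eqP; field; lra.
have := ub (x - a); have := ub (- x - a); lra.
Qed.

End clipping.

Section quadratic_forms.
Context (n : nat) (P : probability (vec n) RR).
Hypothesis int2 : forall i, P.-integrable setT (fun x : vec n => (coord x i ^+ 2)%:E).
Implicit Types (w x : vec n).

Lemma integrable_coordM i j :
  P.-integrable setT (fun x : vec n => (coord x i * coord x j)%:E).
Proof.
apply: (le_integrable _ _ _ (integrableD _ (int2 i) (int2 j))) => //.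
  by apply/measurable_EFinP; apply: measurable_funM; exact: measurable_tnth.
move=> x _; rewrite lee_fin normrM [leRHS]ger0_norm ?addr_ge0 ?sqr_ge0//.
rewrite -(real_normK (num_real (coord x i))) -(real_normK (num_real (coord x j))).
have := sqr_ge0 (`|coord x i| - `|coord x j|); rewrite sqrrB.
by have := sqr_ge0 (`|coord x i| + `|coord x j|); rewrite sqrrD; lra.
Qed.

Lemma integral_dot_sqr w : (\int[P]_x (dot w x ^+ 2)%:E =
  (\sum_(i < n) \sum_(j < n) coord w i * coord w j *
     fine (\int[P]_x (coord x i * coord x j)%:E))%:E)%E.
Proof.
have dotE2 x : (dot w x ^+ 2)%:E = (\sum_(i < n) \sum_(j < n)
    (coord w i * coord w j)%:E * (coord x i * coord x j)%:E)%E.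
  rewrite expr2 /dot mulr_suml -sumEFin; apply: eq_bigr => i _.
  rewrite mulr_sumr -sumEFin; apply: eq_bigr => j _.
  by rewrite -EFinM mulrACA.
have intw i j : P.-integrable setT
    (fun x => ((coord w i * coord w j)%:E * (coord x i * coord x j)%:E)%E).
  by apply: integrableZl => //; exact: integrable_coordM.
under eq_integral do rewrite dotE2.
rewrite integral_sum//; last first.
  by move=> i; apply: integrable_sum => // j _; exact: intw.
rewrite -sumEFin; apply: eq_bigr => i _; rewrite integral_sum// -sumEFin.
apply: eq_bigr => j _; rewrite integralZl//; last exact: integrable_coordM.
rewrite [RHS]EFinM fineK//; apply: integrable_fin_num => //; exact: integrable_coordM.
Qed.

Lemma quadratic_form_subE (C : 'I_n -> 'I_n -> RR) (s : RR) w :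
  \sum_(i < n) \sum_(j < n) coord w i * ((if i == j then s else 0) - C i j) * coord w j =
  s * sqnorm w - \sum_(i < n) \sum_(j < n) coord w i * coord w j * C i j.
Proof.
rewrite /sqnorm mulr_sumr -sumrB; apply: eq_bigr => i _.
rewrite (_ : s * coord w i ^+ 2 =
  \sum_(j < n) coord w i * (if i == j then s else 0) * coord w j); last first.
  rewrite (bigD1 i)//= eqxx big1 ?addr0; last first.
    by move=> j; rewrite eq_sym => /negPf ->; rewrite mulr0 mul0r.
  by ring.
rewrite -sumrB; apply: eq_bigr => j _.
by rewrite !(mulrBr, mulrBl) (mulrAC _ (coord w j)).
Qed.

End quadratic_forms.

Section symmetric_noise.
Context (n : nat) (sigma : RR) (P : probability (vec n) RR) (PXi : Xi_sym sigma P).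
Implicit Types (w x : vec n).

Let msr_dot w : measurable_fun setT (fun x => dot w x : mR).
Proof. by apply: measurable_dot. Qed.

Lemma Xi_sym_second_moment w :
  (\int[P]_x (dot w x ^+ 2)%:E <= (sigma ^+ 2 * sqnorm w)%:E)%E.
Proof.
have [_ i2 mean0 cov] := PXi.
rewrite integral_dot_sqr// lee_fin -subr_ge0.
have := cov (coord w); rewrite quadratic_form_subE.
congr (0 <= _ - _); apply: eq_bigr => i _; apply: eq_bigr => j _; congr (_ * fine _).
by apply: eq_integral => x _; rewrite !mean0 !subr0.
Qed.

Lemma ge0_integral_vopp (f : vec n -> \bar RR) :
  measurable_fun setT f -> (forall x, 0 <= f x)%E ->
  (\int[P]_x f (vopp x) = \int[P]_x f x)%E.
Proof.
move=> mf f0; have [sym _ _ _] := PXi.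
have mopp : measurable_fun setT (@vopp n) by apply: measurable_vopp.
transitivity (\int[pushforward P (@vopp n)]_x f x)%E.
  by rewrite ge0_integral_pushforward.
by apply: eq_measure_integral => //= A mA _; rewrite /pushforward sym.
Qed.

Lemma clip_mgf_le w (l a a' A B : RR) : 0 <= l -> a <= a' -> 0 <= A -> 0 <= B ->
  (forall t, (expR (l * clip (t - a)) + expR (l * clip (- t - a))) / 2 <= A + B * t ^+ 2) ->
  (\int[P]_x (expR (l * clip (dot w x - a')))%:E <=
   (A + B * (sigma ^+ 2 * sqnorm w))%:E)%E.
Proof.
move=> l0 aa' A0 B0 AB.
have mclip b : measurable_fun setT (fun t : mR => expR (l * clip (t - b)) : mR).
  apply: measurable_expRf; apply: measurable_funM => //.
  by apply: (measurableT_comp measurable_clip); exact: measurable_funB.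
pose f x := (expR (l * clip (dot w x - a)) / 2)%:E.
have mf : measurable_fun setT f.
  apply/measurable_EFinP; apply: measurable_funM => //.
  exact: (measurableT_comp (mclip a) (msr_dot w)).
have f0 x : (0 <= f x)%E by rewrite lee_fin divr_ge0// expR_ge0.
apply: (@le_trans _ _ (\int[P]_x (f x + f x))%E).
  apply: ge0_le_integral => //.
  - by apply/measurable_EFinP; exact: (measurableT_comp (mclip a') (msr_dot w)).
  - exact: emeasurable_funD.
  - move=> x _; rewrite /f -EFinD lee_fin -splitr ler_expR ler_wpM2l//.
    by apply: clip_homo; lra.
rewrite ge0_integralD// -[X in (X + _)%E](ge0_integral_vopp mf f0).
have mfo : measurable_fun setT (fun x => f (vopp x)).
  by apply: (measurableT_comp mf); apply: measurable_vopp.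
rewrite -(ge0_integralD P measurableT (fun x _ => f0 (vopp x)) mfo (fun x _ => f0 x) mf).
have m2 : measurable_fun setT (fun x => (dot w x ^+ 2)%:E).
  by apply/measurable_EFinP; apply: measurable_funX; exact: msr_dot.
apply: (@le_trans _ _ (\int[P]_x (A%:E + B%:E * (dot w x ^+ 2)%:E))%E).
  apply: ge0_le_integral => //.
  - by move=> x _; rewrite adde_ge0.
  - exact: (emeasurable_funD mfo mf).
  - by apply: emeasurable_funD => //; apply: measurable_funeM.
  - move=> x _; rewrite /f -EFinM -!EFinD lee_fin dotNr -mulrDl addrC; exact: AB.
rewrite ge0_integralD//; last 2 first.
- by move=> x _; rewrite -EFinM lee_fin mulr_ge0// sqr_ge0.
- exact: measurable_funeM.
rewrite integral_probability_cst EFinD leeD2l// ge0_integralZl_EFin//; last first.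
  by move=> x _; rewrite lee_fin sqr_ge0.
by rewrite EFinM lee_wpmul2l ?lee_fin//; exact: Xi_sym_second_moment.
Qed.

(* The exponent is [l = a / 2] for [a <= 1 / 2] and [l = ln a] for [a > 3]; in
   between, monotonicity of [clip] reduces to the offset [1 / 2]. *)
Lemma clip_mgf w (a a' eps : RR) : 0 < a -> a <= a' -> 0 <= eps <= 1 / 64 ->
  32 * eps <= a -> sigma ^+ 2 * sqnorm w <= 1 / 16 ->
  exists2 l, 0 <= l &
    (\int[P]_x (expR (l * (clip (dot w x - a') + 2 * eps)))%:E <=
     (expR (- (ln (1 + a ^+ 2) / 2 ^+ 10)))%:E)%E.
Proof.
move=> a0 aa' /andP[e0 e64] ea v16.
have v0 : 0 <= sigma ^+ 2 * sqnorm w by rewrite mulr_ge0 ?sqr_ge0 ?sqnorm_ge0.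
have mclip l b : measurable_fun setT (fun x => expR (l * clip (dot w x - b)) : mR).
  apply: measurable_expRf; apply: measurable_funM => //.
  by apply: (measurableT_comp measurable_clip); by apply: measurable_funB => //; exact: msr_dot.
have split_adv l c r : (\int[P]_x (expR (l * clip (dot w x - a')))%:E <= c%:E)%E ->
    expR (l * (2 * eps)) * c <= r ->
    (\int[P]_x (expR (l * (clip (dot w x - a') + 2 * eps)))%:E <= r%:E)%E.
  move=> lc ecr; under eq_integral do rewrite mulrDr addrC expRD EFinM.
  rewrite ge0_integralZl_EFin ?expR_ge0//; last by apply/measurable_EFinP; exact: mclip.
  apply: le_trans (_ : _ <= (expR (l * (2 * eps)) * c)%:E)%E _; last by rewrite lee_fin.
  by rewrite EFinM lee_wpmul2l// lee_fin expR_ge0.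
have p1 : 0 < 1 + a ^+ 2 by rewrite ltr_pwDl// sqr_ge0.
case: (leP a (1 / 2)) => a2.
  exists (a / 2); first lra.
  apply: (split_adv _ (1 - a ^+ 2 / 16)).
    have ha : 0 <= a <= 1 / 2 by lra.
    apply: le_trans.
      by apply: (clip_mgf_le w _ aa' _ _ (fun t => clip_mgf_small t ha)); nra.
    by rewrite lee_fin; set v := _ * sqnorm w in v16 *; have := sqr_ge0 a; nra.
  apply: (@le_trans _ _ (expR (a ^+ 2 / 32) * expR (- (a ^+ 2 / 16)))).
    rewrite ler_pM ?expR_ge0//; [by nra| |exact: expR_ge1Dx].
    by rewrite ler_expR; nra.
  rewrite -expRD ler_expR.
  have := @le_ln1Dx _ (a ^+ 2); have := sqr_ge0 a; nra.
case: (leP a 3) => a3.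
  exists (1 / 4); first lra.
  have h12 : 0 <= (1 / 2 : RR) <= 1 / 2 by lra.
  apply: (split_adv _ (1 - 1 / 64)).
    rewrite (_ : 1 / 4 = 1 / 2 / 2 :> RR); last by field.
    apply: le_trans.
      by apply: (@clip_mgf_le w _ _ a' _ _ _ _ _ _ (fun t => clip_mgf_small t h12)); lra.
    by rewrite lee_fin; set v := _ * sqnorm w in v16 *; lra.
  apply: (@le_trans _ _ (expR (1 / 128) * expR (- (1 / 64)))).
    rewrite ler_pM ?expR_ge0//; [lra| |exact: expR_ge1Dx].
    by rewrite ler_expR; lra.
  rewrite -expRD ler_expR.
  suff : ln (1 + a ^+ 2) <= 5 by lra.
  have -> : 5 = ln (expR 5) :> RR by rewrite expRK.
  rewrite ler_ln ?posrE ?expR_gt0//.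
  have -> : 5 = 5%:R * 1 :> RR by rewrite mulr1.
  rewrite expRM_natl.
  apply: (@le_trans _ _ (2 ^+ 5)); last first.
    by rewrite ler_pXn2r// ?nnegrE ?expR_ge0//; apply: le_trans (expR_ge1Dx 1); lra.
  by rewrite expr2; nra.
have la : 1 / 2 <= ln a.
  rewrite -[leLHS](expRK (1 / 2)) ler_ln ?posrE ?expR_gt0//.
  by apply: (le_trans (@expR_le_quad _ _)); rewrite ?expr2; lra.
exists (ln a); first lra.
apply: (split_adv _ (73 / 64 / a)).
  apply: le_trans.
    apply: (clip_mgf_le w _ aa' _ _ (fun t => clip_mgf_large t (ltW a3))).
    + lra.
    + by rewrite invr_ge0 ltW.
    + by rewrite divr_ge0//; lra.
  rewrite lee_fin (_ : 73 / 64 / a = a^-1 + 9 / (4 * a) * (1 / 16)); last by field; lra.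
  by rewrite lerD2l ler_wpM2l// divr_ge0//; lra.
have -> : 73 / 64 / a = 73 / 64 * expR (- ln a).
  by rewrite expRN lnK ?posrE.
apply: (@le_trans _ _ (expR (ln a * (1 / 32)) * (expR (9 / 64) * expR (- ln a)))).
  apply: ler_pM; rewrite ?mulr_ge0 ?expR_ge0//.
    by rewrite ler_expR ler_wpM2l//; lra.
  by rewrite ler_wpM2r ?expR_ge0//; have := expR_ge1Dx (9 / 64 : RR); lra.
rewrite -!expRD ler_expR.
suff : ln (1 + a ^+ 2) <= 3%:R * ln a by lra.
rewrite mulr_natl -lnXn// ler_ln ?posrE ?exprn_gt0//.
rewrite !exprS expr0; nra.
Qed.

End symmetric_noise.

Lemma card_classical_setE (I : finType) (p : pred I) :
  #|[set i : I | p i]|%:R = \sum_i (p i)%:R :> RR.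
Proof.
rewrite -sum1_card natr_sum big_mkcond/=; apply: eq_bigr => i _.
rewrite [_ \in _](_ : _ = p i); first by case: (p i).
by apply/idP/idP => [/set_mem|pi]; last exact/mem_set.
Qed.

Section pairwise_test.
Context (n N : nat) (sigma : RR).
Implicit Types (g h mu : vec n) (X : sample n N).

(* Compares the projections on the line from g to h with the midpoint, clipped
   at the scale [4 * sigma]; [score g g X = 0] since [0^-1 = 0]. *)
Definition score g h X : RR :=
  \sum_(i < N) clip (dot (vscale (4 * sigma * dist g h)^-1 (vsub h g))
                         (vsub (tnth X i) (vscale (1 / 2) (vadd g h)))).

Lemma score_antisym g h X : score h g X = - score g h X.
Proof.
rewrite /score -sumrN; apply: eq_bigr => i _; rewrite -clipN; congr clip.
rewrite (dist_sym h g) !dotZl -mulrN; congr (_ * _).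
rewrite -dotNl -vsubC; congr (dot _ (vsub _ _)).
by apply: vec_ext => j; rewrite !coordE addrC.
Qed.

Lemma measurable_score g h : measurable_fun setT (fun X => score g h X : mR).
Proof.
apply: measurable_sum => i; apply: (measurableT_comp measurable_clip).
apply: measurable_dot => //; apply: measurable_vsub => //.
exact: measurable_tnth.
Qed.

Lemma score_adversary eps C g h X : adversary eps C ->
  score g h (C X) <= score g h X + 2 * eps * N%:R.
Proof.
move=> [_ /(_ X) CX]; rewrite -lerBlDl /score -sumrB.
apply: (@le_trans _ _ (2 * \sum_(i < N) (tnth (C X) i != tnth X i)%:R)); last first.
  by rewrite -mulrA ler_wpM2l// -card_classical_setE.
rewrite mulr_sumr; apply: ler_sum => i _.
case: eqVneq => [->|_]; first by rewrite subrr mulr0.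
rewrite mulr1.
have := clip_bounded (dot (vscale (4 * sigma * dist g h)^-1 (vsub h g))
  (vsub (tnth (C X) i) (vscale (1 / 2) (vadd g h)))).
have := clip_bounded (dot (vscale (4 * sigma * dist g h)^-1 (vsub h g))
  (vsub (tnth X i) (vscale (1 / 2) (vadd g h)))).
move: (clip _) (clip _) => u v; lra.
Qed.

Lemma measurable_shift_sample mu : measurable_fun setT (@shift_sample n N mu).
Proof.
apply/measurable_fun_tnthP => i.
rewrite (_ : _ \o _ = fun X => vadd mu (tnth X i)); last first.
  by apply/funext => X /=; rewrite tnth_mktuple.
by apply: measurable_vadd => //; exact: measurable_tnth.
Qed.

Lemma score_error eps (P : probability (vec n) RR) C mu g h :
  0 < sigma -> Xi_sym sigma P -> adversary eps C -> 0 <= eps <= 1 / 64 ->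
  0 < dist g h -> 2 ^+ 9 * eps * sigma <= dist g h -> 4 * dist mu g <= dist g h ->
  (iid_expect P (fun xi => (if 0 <= score g h (C (shift_sample mu xi)) then 1 else 0)%:E)
   <= (expR (- (N%:R * (ln (1 + (dist g h / (16 * sigma)) ^+ 2) / 2 ^+ 10))))%:E)%E.
Proof.
move=> s0 PXi aC e64 D0 eD muD.
set D := dist g h in D0 eD muD *; set a := D / (16 * sigma).
have a0 : 0 < a by rewrite divr_gt0// mulr_gt0.
have ea : 32 * eps <= a by rewrite ler_pdivlMr ?mulr_gt0//; lra.
pose w := vscale (4 * sigma * D)^-1 (vsub h g).
pose m := vscale (1 / 2) (vadd g h).
have sD0 : 4 * sigma * D != 0 by rewrite gt_eqF// !mulr_gt0.
have wv : sigma ^+ 2 * sqnorm w <= 1 / 16.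
  rewrite sqnormZ -sqr_dist dist_sym -/D le_eqVlt; apply/orP; left; apply/eqP.
  by field; rewrite !gt_eqF.
pose a' := dot w (vsub m mu).
have aa' : a <= a'.
  rewrite /a' /w dotZl.
  have -> : vsub m mu = vadd (vscale (1 / 2) (vsub h g)) (vopp (vsub mu g)).
    by apply: vec_ext => i; rewrite !coordE; field.
  have := dot_le_dist h g mu g; rewrite (dist_sym h) -/D => /ler_normlW h1.
  have : sqnorm (vsub h g) = D ^+ 2 by rewrite -sqr_dist dist_sym.
  move: (vsub h g) (vsub mu g) h1 => u v h1 uu.
  rewrite dotDr dotNr dotZr -sqnormE uu.
  have -> : a = (4 * sigma * D)^-1 * (D ^+ 2 / 4).
    by rewrite /a; field; rewrite !gt_eqF.
  rewrite ler_pM2l ?invr_gt0 ?mulr_gt0//; nra.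
have [l l0 mgf] := clip_mgf PXi a0 aa' e64 ea wv.
rewrite (_ : expR _ = expR (- (ln (1 + a ^+ 2) / 2 ^+ 10)) ^+ N); last first.
  by rewrite -expRM_natl mulrN.
have mdot : measurable_fun setT (fun x => dot w x : mR) by apply: measurable_dot.
have mg : measurable_fun setT (fun x => expR (l * (clip (dot w x - a') + 2 * eps)) : mR).
  apply: measurable_expRf; apply: measurable_funM => //; apply: measurable_funD => //.
  by apply: (measurableT_comp measurable_clip); apply: measurable_funB.
have := @iid_expect_prod_le _ _ P N _ _ mg (fun x => expR_ge0 _) mgf.
apply: le_trans; apply: le_iid_expect.
- apply/measurable_EFinP; apply: measurable_fun_ifT => //.
  apply: measurable_fun_ler => //; apply: measurableT_comp; first exact: measurable_score.
  by apply: measurableT_comp; [exact: aC.1|exact: measurable_shift_sample].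
- apply/measurable_EFinP; apply: measurable_prod => i _.
  exact: (measurableT_comp mg (measurable_tnth i)).
- by move=> x; case: ifP.
- move=> xi; rewrite lee_fin -expR_sum; case: ifP => [T0|_]; last exact: expR_ge0.
  rewrite -[leLHS]expR0 ler_expR -mulr_sumr mulr_ge0// big_split/= sumr_const.
  rewrite card_ord -[_ *+ N]mulr_natr; apply: (le_trans T0).
  apply: (le_trans (score_adversary _ _ _ aC)). rewrite lerD2r.
  apply: ler_sum => i _; rewrite tnth_mktuple -/w -/m /a' -dotBr.
  apply: clip_homo; rewrite le_eqVlt; apply/orP; left; apply/eqP; congr dot.
  by apply: vec_ext => j; rewrite !coordE; ring.
Qed.

End pairwise_test.

(** * Tournament over a maximal net *)

Section shell_sums.
Implicit Types (w t : RR) (j k N : nat).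

Lemma ln1D_concave (B w w0 : RR) : 0 <= B -> 0 <= w <= w0 -> 0 < w0 ->
  w / w0 * ln (1 + B * w0) <= ln (1 + B * w).
Proof.
move=> B0 /andP[w_ge0 ww0] w0_gt0.
have t0 : 0 <= w / w0 by rewrite divr_ge0// ltW.
have t1 : w / w0 <= 1 by rewrite ler_pdivrMr// mul1r.
have p0 : 0 < 1 + B * w0 by rewrite ltr_pwDl// mulr_ge0// ltW.
have p : 0 < 1 + B * w by rewrite ltr_pwDl// mulr_ge0.
rewrite -[leLHS]expRK ler_ln ?posrE ?expR_gt0//.
have := @convex_expR RR (Itv01 t0 t1) (ln (1 + B * w0)) 0.
rewrite !convRE /= mulr0 addr0 expR0 lnK ?posrE// mulr1 => h.
apply: (le_trans h); rewrite le_eqVlt; apply/orP; left; apply/eqP.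
by rewrite /unstable.onem; field; rewrite gt_eqF.
Qed.

(* By concavity of [ln] it suffices to compare both sides at the largest [w]. *)
Lemma entropy_beats_test w j : 0 <= w <= (2 ^+ 12)^-1 -> (22 <= j)%N ->
  w * (j + 2)%:R <= ln (1 + 4 ^+ j / 2 ^+ 8 * w) / 2 ^+ 11.
Proof.
move=> ww j22; have w0 : 0 < (2 ^+ 12)^-1 :> RR by rewrite invr_gt0 exprn_gt0.
have B0 : 0 <= 4 ^+ j / 2 ^+ 8 :> RR by rewrite divr_ge0 ?exprn_ge0.
have := ln1D_concave B0 ww w0; rewrite invrK => h.
suff h1 : (j + 2)%:R / 2 <= ln (1 + 4 ^+ j / 2 ^+ 8 * (2 ^+ 12)^-1) :> RR.
  have w_ge0 : 0 <= w by case/andP: ww.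
  rewrite ler_pdivlMr ?exprn_gt0//; apply: le_trans h.
  have := ler_wpM2l (mulr_ge0 w_ge0 (exprn_ge0 12 (ler0n RR 2))) h1.
  by apply: le_trans; rewrite le_eqVlt; apply/orP; left; apply/eqP; field.
have p0 : 0 < 1 + 4 ^+ j / 2 ^+ 8 * (2 ^+ 12)^-1 :> RR.
  by rewrite ltr_pwDl ?ltr01// mulr_ge0 ?invr_ge0 ?exprn_ge0.
rewrite -[leLHS]expRK ler_ln ?posrE ?expR_gt0//.
rewrite -[X in _ * X]mul1r expRM_natl.
apply: (@le_trans _ _ (2 ^+ (j + 2))).
  rewrite ler_pXn2r ?addn2// ?nnegrE ?expR_ge0//.
  by apply: (le_trans (@expR_le_quad _ _)); rewrite ?expr2; lra.
apply: (@le_trans _ _ (4 ^+ j / 2 ^+ 8 * (2 ^+ 12)^-1)); last by rewrite lerDr ler01.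
have -> : j = (22 + (j - 22))%N by rewrite subnKC.
move: (j - 22)%N => k; rewrite !exprD.
have -> : (4 : RR) ^+ k = 2 ^+ k * 2 ^+ k by rewrite -exprMn; congr (_ ^+ _); lra.
have k1 : 1 <= 2 ^+ k :> RR by rewrite exprn_ege1// ler1n.
have -> : (4 : RR) ^+ 22 * (2 ^+ k * 2 ^+ k) / 2 ^+ 8 / 2 ^+ 12 = 2 ^+ 24 * 2 ^+ k * 2 ^+ k.
  by field.
have -> : (2 : RR) ^+ 22 * 2 ^+ k * 2 ^+ 2 = 2 ^+ 24 * 2 ^+ k by ring.
by rewrite ler_peMr ?mulr_ge0 ?exprn_ge0.
Qed.

Lemma bernoulli_sqr (x : RR) p : 0 <= x -> (p%:R * x) ^+ 2 <= (1 + x) ^+ (2 * p).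
Proof.
move=> x0; rewrite mulnC exprM ler_pXn2r// ?nnegrE ?mulr_ge0 ?exprn_ge0 ?addr_ge0//.
elim: p => [|p IH]; first by rewrite mul0r exprn_ge0// addr_ge0.
have e1 : 1 <= (1 + x) ^+ p by rewrite exprn_ege1// lerDl.
rewrite exprS -natr1; nra.
Qed.

Lemma shell_term_le N w j : 0 <= w <= (2 ^+ 12)^-1 -> (22 <= j)%N ->
  2 ^+ 12 <= N%:R :> RR -> 1 / 2 <= N%:R * w ->
  expR (N%:R * w) ^+ (j + 2) * 4 ^+ j.+1 *
    expR (- (N%:R * (ln (1 + 4 ^+ j / 2 ^+ 8 * w) / 2 ^+ 10))) <= 2 ^+ 46 / 4 ^+ j.
Proof.
move=> ww j22 N2 Nw; have w_ge0 : 0 <= w by case/andP: ww.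
have [B BE] : exists B : RR, B = 4 ^+ j / 2 ^+ 8 by exists (4 ^+ j / 2 ^+ 8).
have h := entropy_beats_test ww j22; rewrite -BE in h *.
have B0 : 0 <= B by rewrite BE divr_ge0 ?exprn_ge0.
have p0 : 0 < 1 + B * w by rewrite ltr_pwDl ?ltr01 ?mulr_ge0.
have L0 : 0 <= ln (1 + B * w) by rewrite ln_ge0 ?lerDl ?mulr_ge0.
have e0 := lnK p0; move: (ln (1 + B * w)) h L0 e0 => L h L0 LE.
have N0 : 0 <= N%:R :> RR by exact: ler0n.
have p4 : 0 < 4 ^+ j :> RR by rewrite exprn_gt0.
have two k : 0 < 2 ^+ k :> RR by rewrite exprn_gt0.
pose p := Num.truncn (N%:R / 2 ^+ 12 : RR).
have Nd0 : 0 <= N%:R / 2 ^+ 12 :> RR by rewrite divr_ge0 ?ler0n ?exprn_ge0.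
have p1 : 1 <= p%:R :> RR.
  by rewrite ler1n truncn_gt0 ler_pdivlMr// mul1r.
have pN : p%:R * 2 ^+ 12 <= N%:R :> RR by rewrite -ler_pdivlMr// truncn_le.
have Np : N%:R <= 2 ^+ 13 * p%:R :> RR.
  have := truncnS_gt (N%:R / 2 ^+ 12 : RR); rewrite -/p ltr_pdivrMr// => /ltW/le_trans.
  apply; have -> : 2 ^+ 13 * p%:R = (p%:R + p%:R) * 2 ^+ 12 :> RR by ring.
  by rewrite ler_pM2r// -[p.+1%:R]natr1 lerD2l.
have key : (4 ^+ j) ^+ 2 <= 2 ^+ 44 * expR (N%:R / 2 ^+ 11 * L) :> RR.
  have h1 : (1 + B * w) ^+ (2 * p) <= expR (N%:R / 2 ^+ 11 * L).
    rewrite -LE -expRM_natl ler_expR natrM ler_wpM2r// ler_pdivlMr//.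
    by apply: le_trans pN; rewrite le_eqVlt; apply/orP; left; apply/eqP; ring.
  have pw : 1 <= 2 ^+ 14 * (p%:R * w).
    have := ler_wpM2r w_ge0 Np; move/(le_trans Nw) => h2.
    have -> : 2 ^+ 14 * (p%:R * w) = 2 * (2 ^+ 13 * p%:R * w) by ring.
    by rewrite mulrC -ler_pdivrMr.
  have hB : 4 ^+ j <= 2 ^+ 22 * (p%:R * (B * w)).
    have -> : 2 ^+ 22 * (p%:R * (B * w)) = 4 ^+ j * (2 ^+ 14 * (p%:R * w)).
      by rewrite BE; field.
    by rewrite ler_peMr// ltW.
  apply: (@le_trans _ _ ((2 ^+ 22 * (p%:R * (B * w))) ^+ 2)).
    by rewrite ler_pXn2r ?nnegrE ?(ltW p4)//; exact: le_trans (ltW p4) hB.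
  rewrite exprMn -exprM ler_wpM2l ?exprn_ge0//; apply: le_trans h1.
  by apply: bernoulli_sqr; rewrite mulr_ge0.
rewrite -expRM_natl [leLHS]mulrAC -expRD [4 ^+ j.+1]exprS.
apply: (@le_trans _ _ (expR (- (N%:R / 2 ^+ 11 * L)) * (4 * 4 ^+ j))).
  rewrite ler_wpM2r ?mulr_ge0 ?(ltW p4) ?ler0n// ler_expR.
  have := ler_wpM2l N0 h; rewrite addn2.
  have -> : N%:R * (L / 2 ^+ 10) = 2 * (N%:R / 2 ^+ 11 * L) by field.
  have -> : N%:R * (L / 2 ^+ 11) = N%:R / 2 ^+ 11 * L by field.
  rewrite (mulrA N%:R) [_ * j.+2%:R]mulrC.
  move: (N%:R / 2 ^+ 11 * L) (j.+2%:R * _) => x y; clear; lra.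
rewrite ler_pdivlMr// expRN; have := expR_gt0 (N%:R / 2 ^+ 11 * L).
move: (expR _) (4 ^+ j) key => x u key x0.
have -> : x^-1 * (4 * u) * u = 4 * u ^+ 2 / x by ring.
rewrite ler_pdivrMr//.
have -> : (2 : RR) ^+ 46 * x = 4 * (2 ^+ 44 * x) by ring.
by rewrite ler_pM2l.
Qed.

Lemma geometric_half_sum m : \sum_(k < m) (1 / 2) ^+ k <= 2 :> RR.
Proof.
suff -> : \sum_(k < m) (1 / 2) ^+ k = 2 - 2 * (1 / 2) ^+ m :> RR.
  by rewrite gerBl mulr_ge0// exprn_ge0.
elim: m => [|m IH]; first by rewrite big_ord0 expr0; lra.
by rewrite big_ord_recr/= IH exprS; field.
Qed.

Lemma dyadic_shell (r d : RR) : 0 < r -> r < d -> exists k, r * 2 ^+ k < d <= r * 2 ^+ k.+1.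
Proof.
move=> r0 rd.
have ex : exists k, d <= r * 2 ^+ k.
  exists (Num.truncn (d / r)).+1.
  rewrite mulrC -ler_pdivrMr//.
  have d0 : 0 <= d / r by rewrite divr_ge0 ?ltW//; exact: lt_trans rd.
  have /ltW/le_trans := truncnS_gt (d / r); apply.
  by rewrite -natrX ler_nat ltnW// ltn_expl.
case: (ex_minnP ex) => -[|k] hk kmin.
  by move: hk; rewrite expr0 mulr1 leNgt rd.
by exists k; rewrite hk andbT ltNge; apply/negP => /kmin; rewrite ltnn.
Qed.

Lemma separated_shell_sum n (K : set (vec n)) (eta sigma : RR) N (g0 : vec n)
    (s : seq (vec n)) :
  0 < eta -> 0 < sigma -> (eta / sigma) ^+ 2 <= (2 ^+ 12)^-1 -> 2 ^+ 12 <= N%:R :> RR ->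
  1 / 2 <= N%:R * (eta / sigma) ^+ 2 ->
  (forall k nu s, K nu -> uniq s ->
    (forall x, x \in s -> K x /\ dist x nu <= eta * 2 ^+ k) ->
    separated (eta / 2) s -> (size s)%:R <= expR (N%:R * (eta / sigma) ^+ 2) ^+ k.+1) ->
  K g0 -> uniq s -> (forall x, x \in s -> K x) -> separated (eta / 2) s ->
  \sum_(h <- s | eta * 2 ^+ 22 < dist g0 h)
    dist g0 h ^+ 2 * expR (- (N%:R * (ln (1 + (dist g0 h / (16 * sigma)) ^+ 2) / 2 ^+ 10)))
  <= 2 ^+ 47 * eta ^+ 2.
Proof.
move=> eta0 s0 w12 N2 Nw count Kg0 us sK sep.
set w := (eta / sigma) ^+ 2 in w12 Nw count.
have w0 : 0 <= w by exact: sqr_ge0.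
pose r := eta * 2 ^+ 22; have r0 : 0 < r by rewrite mulr_gt0// exprn_gt0.
have /choice[kk kkP] h : exists k : nat, r < dist g0 h ->
    r * 2 ^+ k < dist g0 h <= r * 2 ^+ k.+1.
  have [rh|rh] := ltP r (dist g0 h); last by exists 0%N.
  by have [k kP] := dyadic_shell r0 rh; exists k.
pose m := (\max_(h <- s) kk h).+1.
pose f h := dist g0 h ^+ 2 *
  expR (- (N%:R * (ln (1 + (dist g0 h / (16 * sigma)) ^+ 2) / 2 ^+ 10))).
pose p k : RR := expR (- (N%:R * (ln (1 + 4 ^+ (22 + k) / 2 ^+ 8 * w) / 2 ^+ 10))).
pose t k := eta ^+ 2 * 4 ^+ (22 + k).+1 * p k.
have ft h : r < dist g0 h -> f h <= t (kk h).
  move=> rh; have /andP[h1 h2] := kkP h rh.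
  have rk0 : 0 < r * 2 ^+ kk h by rewrite mulr_gt0// exprn_gt0.
  have rE k : (r * 2 ^+ k) ^+ 2 = eta ^+ 2 * 4 ^+ (22 + k).
    rewrite /r -mulrA -exprD exprMn -exprM mulnC exprM; congr (_ * _ ^+ _); lra.
  apply: ler_pM; rewrite ?sqr_ge0 ?expR_ge0//.
    by rewrite -addnS -rE ler_pXn2r// ?nnegrE ?dist_ge0// mulr_ge0 ?exprn_ge0 ?ltW.
  rewrite ler_expR lerN2 ler_wpM2l// ler_wpM2r//.
  rewrite ler_ln ?posrE ?lerD2l; last 2 first.
  - by rewrite ltr_pwDl// mulr_ge0// divr_ge0// exprn_ge0.
  - by rewrite ltr_pwDl// sqr_ge0.
  rewrite (_ : _ * w = (r * 2 ^+ kk h / (16 * sigma)) ^+ 2).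
    have s16 : 0 < 16 * sigma by rewrite mulr_gt0.
    rewrite ler_pXn2r ?nnegrE ?divr_ge0 ?dist_ge0 ?(ltW rk0) ?(ltW s16)//.
    by rewrite ler_pM2r ?invr_gt0// ltW.
  by rewrite expr_div_n rE /w; field; rewrite gt_eqF.
have t0 k : 0 <= t k by apply: mulr_ge0 (expR_ge0 _); rewrite mulr_ge0 ?sqr_ge0 ?exprn_ge0.
apply: (@le_trans _ _ (\sum_(h <- s | r < dist g0 h) \sum_(k < m | k == kk h :> nat) t k)).
  rewrite big_seq_cond [leRHS]big_seq_cond; apply: ler_sum => h /andP[hs rh].
  have km : (kk h < m)%N by rewrite ltnS; apply: leq_bigmax_seq.
  by rewrite (big_pred1 (Ordinal km))//; exact: ft.
rewrite (exchange_big_dep xpredT)//=.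
apply: (@le_trans _ _ (\sum_(k < m) (2 ^+ 46 * eta ^+ 2) * (1 / 2) ^+ k)); last first.
  have := geometric_half_sum m; rewrite -mulr_sumr.
  have := sqr_ge0 eta; set e := eta ^+ 2; set S := \sum_(_ < _) _ => e0 S2.
  have -> : 2 ^+ 47 * e = 2 ^+ 46 * e * 2 by ring.
  by rewrite ler_wpM2l// mulr_ge0.
apply: ler_sum => k _.
rewrite big_const_seq iter_addr_0 -[X in X <= _]mulr_natl -size_filter.
apply: (@le_trans _ _ (expR (N%:R * w) ^+ (22 + k).+2 * t k)).
  rewrite ler_wpM2r//; apply: (count _ g0) => //; first exact: filter_uniq.
    move=> x; rewrite mem_filter => /andP[/andP[rx /eqP kx] xs]; split; first exact: sK.
    have /andP[_] := kkP x rx; rewrite -kx dist_sym => /le_trans; apply.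
    by rewrite /r -mulrA -exprD addnS.
  by apply: separated_sub sep => x; rewrite mem_filter => /andP[].
have := @shell_term_le N w (22 + k) _ (leq_addr _ _) N2 Nw.
rewrite w0 w12 => /(_ isT); rewrite addn2 => h.
rewrite /t [leLHS](_ : _ = eta ^+ 2 * (expR (N%:R * w) ^+ (22 + k).+2 * 4 ^+ (22 + k).+1 * p k)); last by ring.
rewrite [2 ^+ 46 * _]mulrC -[leRHS]mulrA ler_wpM2l ?sqr_ge0//; apply: (le_trans h).
rewrite ler_wpM2l ?exprn_ge0// div1r exprVn lef_pV2 ?posrE ?exprn_gt0//.
rewrite exprD -[leLHS]mul1r ler_pM ?exprn_ge0//; first by rewrite exprn_ege1// ler1n.
by apply: lerXn2r; rewrite ?nnegrE ?ler_nat.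
Qed.

End shell_sums.

Section maximal_net.
Context (n : nat) (K : set (vec n)).

Lemma maximal_separated_set (r : RR) : 0 <= r -> exists G : set (vec n),
  [/\ G `<=` K, (forall x y, G x -> G y -> x != y -> r < dist x y) &
      forall x, K x -> exists2 y, G y & dist x y <= r].
Proof.
move=> r0.
pose S (G : set (vec n)) := G `<=` K /\
  (forall x y, G x -> G y -> x != y -> r < dist x y).
have [F FS Ftot|G [[GK Gsep] Gmax]] := @Zorn_bigcup _ S.
  split=> [x [A FA Ax]|x y [A FA Ax] [B FB By] xy]; first exact: (FS A FA).1.
  by have [AB|BA] := Ftot _ _ FA FB;
    [apply: (FS B FB).2 => //; exact: AB|apply: (FS A FA).2 => //; exact: BA].
exists G; split=> // x Kx; apply: contrapT => far.
have far' y : G y -> r < dist x y.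
  by move=> Gy; rewrite ltNge; apply/negP => xy; apply: far; exists y.
apply: (Gmax (G `|` [set x])).
  split; first by move=> y Gy; left.
  by move=> /(_ x (or_intror erefl)) /far'; rewrite distxx ltNge r0.
split=> [y [/GK//|->//]|y z [Gy|->] [Gz|->]].
- exact: Gsep.
- by move=> _; rewrite dist_sym; exact: far'.
- by move=> _; exact: far'.
- by rewrite eqxx.
Qed.

Lemma countable_of_ball_size (G : set (vec n)) (nu : vec n) (eta : RR) (b : nat -> RR) :
  0 < eta ->
  (forall k s, uniq s -> (forall x, x \in s -> G x /\ dist x nu <= eta * 2 ^+ k) ->
     (size s)%:R <= b k) ->
  countable G.
Proof.
move=> eta0 bnd.
have -> : G = \bigcup_k (G `&` [set x | dist x nu <= eta * 2 ^+ k]).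
  apply/seteqP; split=> [x Gx|x [k _ []//]].
  have [rh|rh] := leP (dist x nu) eta.
    by exists 0%N => //; split=> //=; rewrite expr0 mulr1.
  have [k /andP[_ h]] := dyadic_shell eta0 rh.
  by exists k.+1.
apply: bigcup_countable => // k _; apply: finite_set_countable.
apply: contrapT => inf.
have [A AG /=] := infinite_set_fset (Num.truncn (b k)).+1 inf.
apply/negP; rewrite -ltnNge -(ltr_nat RR).
apply: le_lt_trans (truncnS_gt (b k)); apply: bnd; first exact: finmap.fset_uniq.
by move=> x xA; apply: AG.
Qed.

End maximal_net.

Section tournament.
Context (n N : nat) (sigma : RR).

Lemma measurable_first {d d'} {T : measurableType d} {T' : measurableType d'}
    (A : nat -> set T) (e : nat -> T') :
  (forall j, measurable (A j)) ->
  exists2 F : T -> T', measurable_fun setT F &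
    forall x, (exists j, A j x) -> exists2 j, A j x & F x = e j.
Proof.
move=> mA; have mB j : measurable (seqDU A j).
  by apply: measurableD => //; apply: bigsetU_measurable.
have AB x : (exists j, A j x) -> exists j, seqDU A j x.
  move=> [j Ajx]; have : (\bigcup_i seqDU A i) x by rewrite -seqDU_bigcup_eq; exists j.
  by move=> [i _]; exists i.
have Binj x i j : seqDU A i x -> seqDU A j x -> i = j.
  move=> Bi Bj; have /trivIsetP/(_ i j I I) h := trivIset_seqDU A.
  apply/eqP/negPn/negP => /h h0; suff : (set0 : set T) x by [].
  by rewrite -h0; split.
pose F x := if pselect (exists j, seqDU A j x) is left h then e (projT1 (cid h))
            else e 0%N.
have FE j x : seqDU A j x -> F x = e j.
  move=> Bjx; rewrite /F; case: pselect => [h|[]]; last by exists j.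
  by congr e; apply: Binj Bjx; exact: (projT2 (cid h)).
exists F => [_ S mS|x /AB[j Bjx]]; last by exists j; [case: Bjx|exact: FE].
rewrite setTI (_ : F @^-1` S = \bigcup_j (if pselect (S (e j)) is left _ then seqDU A j else set0)
   `|` (if pselect (S (e 0%N)) is left _ then ~` \bigcup_j seqDU A j else set0)).
  apply: measurableU; first by apply: bigcup_measurable => j _; case: pselect.
  case: pselect => // _; apply: measurableC; exact: bigcup_measurable.
apply/seteqP; split=> [x|x [[j _]|]].
- have [[j Bjx] SFx|nB] := pselect (exists j, seqDU A j x).
    left; exists j => //; case: pselect => //; apply.
    by rewrite -(FE j x).
  rewrite /preimage/= {1}/F; case: pselect => // _ Se0; right; case: pselect => //.
  by move=> _ [j _ Bjx]; apply: nB; exists j.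
- by case: pselect => // Sej Bjx; rewrite /preimage/= (FE j).
- case: pselect => // Se0 nB; rewrite /preimage/= /F; case: pselect => // -[j Bjx].
  by exfalso; apply: nB; exists j.
Qed.

(* The estimator selects a point that beats all its rivals outside a ball of
   the smallest possible radius; two such points beat each other unless they
   are within that radius. *)
Lemma tournament_estimator (G : set (vec n)) (eta : RR) : 0 < eta ->
  countable G -> exists2 muhat : sample n N -> vec n, estimator muhat &
    forall X g0 (s : RR), 0 <= s -> G g0 ->
      (forall h, G h -> 0 <= score sigma g0 h X -> dist g0 h <= s) ->
      dist (muhat X) g0 <= s + eta.
Proof.
move=> eta0 /countable_injP[f finj].
pose e k := xget (vzero n) [set g | G g /\ f g = k].
have ef g : G g -> e (f g) = g.
  move=> Gg; have [Ge fe] : G (e (f g)) /\ f (e (f g)) = f g.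
    by apply: (@xgetPex _ (vzero n) [set g' | G g' /\ f g' = f g]); exists g.
  by apply: finj; rewrite ?inE.
pose good k g := [set X : sample n N | forall h, G h -> eta * k%:R < dist g h ->
  score sigma g h X < 0].
pose A k j := if pselect (G (e j)) is left _ then good k (e j) else set0.
have mgood k g : measurable (good k g).
  rewrite (_ : good k g = \bigcap_j (if pselect (G (e j) /\ eta * k%:R < dist g (e j))
     is left _ then [set X | score sigma g (e j) X < 0] else setT)).
    apply: bigcap_measurable => // j _; case: pselect => // _.
    have h : measurable_fun setT (fun X : sample n N => score sigma g (e j) X < 0).
      by apply: measurable_fun_ltr => //; exact: measurable_score.
    by have := h measurableT [set true] I; rewrite setTI.
  apply/seteqP; split=> [X gX j _|X gX h Gh gh].
    by case: pselect => // -[Gej gej]; exact: gX.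
  have := gX (f h) I; rewrite ef//; case: pselect => // -[]; by split.
have mA k j : measurable (A k j) by rewrite /A; case: pselect.
pose B j := \bigcup_k (A k j `&` ~` \bigcup_(k' in `I_k) \bigcup_j' A k' j').
have mB j : measurable (B j).
  apply: bigcup_measurable => k _; apply: measurableI => //; apply: measurableC.
  by apply: bigcup_measurable => k' _; exact: bigcup_measurable.
have [muhat mmu muP] := measurable_first e mB.
exists muhat => // X g0 s s0 Gg0 g0s.
pose k := (Num.truncn (s / eta)).+1.
have sk : s <= eta * k%:R.
  by rewrite mulrC -ler_pdivrMr//; exact/ltW/truncnS_gt.
have ks : eta * k%:R <= s + eta.
  rewrite -natr1 mulrDr mulr1 lerD2r mulrC -ler_pdivlMr//.
  by rewrite truncn_le// divr_ge0// ltW.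
have Ak : exists k' j, A k' j X.
  exists k, (f g0); rewrite /A ef//; case: pselect => // _ h Gh g0h.
  by rewrite ltNge; apply/negP => /(g0s h Gh); rewrite leNgt (le_lt_trans sk).
have kmin_ex : exists k', `[< exists j, A k' j X >].
  by have [k' Ak'] := Ak; exists k'; apply/asboolP.
have [j] : exists j, B j X.
  case: (ex_minnP kmin_ex) => k0 /asboolP[j Akj] kmin; exists j, k0 => //; split=> //.
  by move=> [k' /= k'k0 [j' _ Aj']]; have := kmin k' (asboolT (ex_intro _ j' Aj')); rewrite leqNgt k'k0.
move=> Bj; have {j Bj}[j [k0 _ [Akj kmin]] ->] := muP X (ex_intro _ j Bj).
move: Akj; rewrite /A; case: pselect => // Gej goodj.
have k0k : (k0 <= k)%N.
  rewrite leqNgt; apply/negP => kk0; apply: kmin; exists k => //.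
  exists (f g0) => //; rewrite /A ef//; case: pselect => // _ h Gh g0h.
  by rewrite ltNge; apply/negP => /(g0s h Gh); rewrite leNgt (le_lt_trans sk).
apply: le_trans ks; rewrite leNgt; apply/negP => far.
have h1 : score sigma (e j) g0 X < 0.
  by apply: goodj => //; apply: le_lt_trans far; rewrite ler_pM2l// ler_nat.
have : dist g0 (e j) <= s.
  by apply: g0s => //; rewrite score_antisym oppr_ge0 ltW.
by rewrite dist_sym leNgt (le_lt_trans sk).
Qed.

End tournament.

Section upper_bound.
Context (n N : nat).
Implicit Types (K G : set (vec n)) (g h mu : vec n).

Lemma nneseries_le (u : nat -> \bar RR) (c : \bar RR) : (forall k, 0 <= u k)%E ->
  (forall m, \sum_(0 <= k < m) u k <= c)%E -> (\sum_(k <oo) u k <= c)%E.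
Proof.
move=> u0 uc; apply: lime_le; last by apply: nearW => m; exact: uc.
by apply: is_cvg_nneseries => k _ _; exact: u0.
Qed.

Lemma countable_enumeration (T : choiceType) (x0 : T) (G : set T) : countable G ->
  exists (D : pred nat) (e : nat -> T), [/\ forall k, D k -> G (e k),
    forall y, G y -> exists2 k, D k & e k = y & {in D &, injective e}].
Proof.
move=> /countable_injP[f finj].
pose e k := xget x0 [set y | G y /\ f y = k].
pose D k := `[< exists2 y, G y & f y = k >].
have De k : D k -> G (e k) /\ f (e k) = k.
  by move=> /asboolP[g Gg fg]; apply: (@xgetPex _ x0 [set y' | G y' /\ f y' = k]); exists g.
exists D, e; split=> [k /De[]//|y Gy|j k].
  have Dy : D (f y) by apply/asboolP; exists y.
  by exists (f y) => //; have [Ge fe] := De _ Dy; apply: finj; rewrite ?inE.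
by rewrite -![_ \in D]/(D _) => /De[_ fj] /De[_ fk] ejk; rewrite -fj ejk fk.
Qed.

Lemma upper_risk K (sigma eps eta : RR) : 0 < sigma -> 0 <= eps <= 1 / 64 ->
  0 < eta -> eps * sigma <= eta -> (eta / sigma) ^+ 2 <= (2 ^+ 12)^-1 ->
  2 ^+ 12 <= N%:R :> RR -> 1 / 2 <= N%:R * (eta / sigma) ^+ 2 -> K !=set0 ->
  (forall eta' nu s, eta <= eta' -> K nu -> uniq s ->
     (forall x, x \in s -> K x /\ dist x nu <= eta') ->
     separated (eta' / 2) s -> (size s)%:R <= expR (N%:R * (eta / sigma) ^+ 2)) ->
  (minimax_sym N K sigma eps <= (2 ^+ 49 * eta ^+ 2)%:E)%E.
Proof.
move=> s0 e64 eta0 eps_eta w12 N12 Nw [nu0 Knu0] H.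
have count := separated_ball_size eta0 H.
have eta2 : 0 <= eta / 2 by rewrite divr_ge0// ltW.
have [G [GK Gsep Gcov]] := maximal_separated_set K eta2.
have sepG s : (forall x, x \in s -> G x) -> separated (eta / 2) s.
  by move=> sG x y xs ys; apply: Gsep; exact: sG.
have cG : countable G.
  apply: (@countable_of_ball_size _ G nu0 eta _ eta0) => k s us sG.
  apply: (count k nu0) => //; first by move=> x /sG[/GK].
  by apply: sepG => x /sG[].
have [muhat mmu muP] := tournament_estimator N sigma eta0 cG.
have [D [e [DG Gex einj]]] := countable_enumeration (vzero n) cG.
apply: le_trans (_ : worst_risk K sigma eps muhat <= _)%E.
  by apply: ereal_inf_lbound; exists muhat.
apply/ereal_supP => _ [mu [P [C [Kmu PXi aC ->]]]].
have [g0 Gg0 mug0] := Gcov mu Kmu.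
pose r := eta * 2 ^+ 22.
pose act k := D k && (r < dist g0 (e k)).
pose u k X : \bar RR := (if act k then dist g0 (e k) ^+ 2 *
  (if 0 <= score sigma g0 (e k) (C (shift_sample mu X)) then 1 else 0) else 0)%:E.
have u0 k X : (0 <= u k X)%E.
  by rewrite lee_fin; case: ifP => // _; rewrite mulr_ge0 ?sqr_ge0//; case: ifP.
have mind k : measurable_fun setT (fun X : sample n N =>
    (if 0 <= score sigma g0 (e k) (C (shift_sample mu X)) then 1 else 0) : mR).
  apply: measurable_fun_ifT => //; apply: measurable_fun_ler => //.
  apply: (measurableT_comp (measurable_score _ _ _)).
  exact: (measurableT_comp aC.1 (@measurable_shift_sample _ _ mu)).
have mu_ k : measurable_fun setT (u k).
  apply/measurable_EFinP; rewrite /u; case: (act k) => //.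
  by apply: measurable_funM => //; exact: mind.
pose S X := ((r ^+ 2)%:E + \sum_(k <oo) u k X)%E.
have S0 X : (0 <= S X)%E.
  by rewrite adde_ge0 ?lee_fin ?sqr_ge0// nneseries_ge0.
have mS : measurable_fun setT S.
  by apply: emeasurable_funD => //; apply: ge0_emeasurable_sum => // k.
pose f X := (sqnorm (vsub (muhat (C (shift_sample mu X))) mu))%:E.
have fS X : (f X <= 2%:E * S X + (5 * eta ^+ 2)%:E)%E.
  rewrite /f; set Y := C _.
  have [->|] := eqVneq (S X) +oo%E; first by rewrite gt0_muley ?lte_fin// addye// leey.
  rewrite -ltey => Sfin.
  have SE : S X \is a fin_num by rewrite ge0_fin_numE.
  rewrite -(fineK SE) -EFinM -EFinD lee_fin.
  set s := fine (S X).
  have s_ge0 : 0 <= s by rewrite -lee_fin fineK.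
  have rs : r ^+ 2 <= s.
    by rewrite -lee_fin fineK// leeDl// nneseries_ge0.
  have us k : act k -> 0 <= score sigma g0 (e k) Y -> dist g0 (e k) ^+ 2 <= s.
    move=> ak sk; rewrite -lee_fin fineK// /S.
    apply: (@le_trans _ _ (\sum_(k <oo) u k X)%E); last first.
      by rewrite leeDr// lee_fin sqr_ge0.
    apply: le_trans (nneseries_lim_ge k.+1 (fun i _ _ => u0 i X)).
    rewrite big_nat_recr//= {2}/u ak sk mulr1 leeDr//.
    by rewrite sume_ge0.
  have sq0 : 0 <= Num.sqrt s := sqrtr_ge0 s.
  have h1 : dist (muhat Y) g0 <= Num.sqrt s + eta.
    apply: muP => // h Gh sh; rewrite -(ger0_norm (dist_ge0 g0 h)) -sqrtr_sqr.
    rewrite ler_wsqrtr//; have [rh|hr] := ltP r (dist g0 h).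
      have [k Dk ek] := Gex h Gh; rewrite -ek; apply: us; last by rewrite ek.
      by rewrite /act Dk ek.
    by apply: le_trans rs; rewrite lerXn2r ?nnegrE ?dist_ge0// mulr_ge0 ?(ltW eta0) ?exprn_ge0.
  have h2 : dist (muhat Y) mu <= Num.sqrt s + eta + eta / 2.
    by apply: (le_trans (dist_triangle g0 _ _)); rewrite lerD// dist_sym.
  rewrite -sqr_dist; apply: (@le_trans _ _ ((Num.sqrt s + eta + eta / 2) ^+ 2)).
    by rewrite lerXn2r ?nnegrE ?dist_ge0// !addr_ge0// ltW.
  rewrite -[in leRHS](sqr_sqrtr s_ge0).
  by have := sqr_ge0 (Num.sqrt s - 3 / 2 * eta); rewrite !expr2; nra.
have [Q QE] := iid_expect_probability P N.
have mf : measurable_fun setT f.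
  apply/measurable_EFinP; apply: measurable_sqnorm; apply: measurable_vsub => //.
  apply: (measurableT_comp mmu).
  exact: (measurableT_comp aC.1 (@measurable_shift_sample _ _ mu)).
have e5 : 0 <= 5 * eta ^+ 2 by rewrite mulr_ge0 ?sqr_ge0.
rewrite /risk -/f QE//; last by move=> X; rewrite lee_fin sqnorm_ge0.
apply: (@le_trans _ _ (\int[Q]_X (2%:E * S X + (5 * eta ^+ 2)%:E))%E).
  apply: ge0_le_integral => //.
  - by move=> X _; rewrite lee_fin sqnorm_ge0.
  - by apply: emeasurable_funD => //; apply: measurable_funeM.
have S2 X : (0 <= 2%:E * S X)%E by rewrite mule_ge0// lee_fin.
rewrite ge0_integralD//; last exact: measurable_funeM.
rewrite integral_probability_cst ge0_integralZl_EFin//.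
rewrite ge0_integralD//; last first.
- by apply: ge0_emeasurable_sum => // k.
- by move=> X _; apply: nneseries_ge0.
- by move=> X _; rewrite lee_fin sqr_ge0.
rewrite integral_probability_cst integral_nneseries//.
have series : (\sum_(k <oo) \int[Q]_X u k X <= (2 ^+ 47 * eta ^+ 2)%:E)%E.
  apply: nneseries_le => [k|m]; first exact: integral_ge0.
  pose F h := dist g0 h ^+ 2 *
    expR (- (N%:R * (ln (1 + (dist g0 h / (16 * sigma)) ^+ 2) / 2 ^+ 10))).
  have ik k : (\int[Q]_X u k X <= (if act k then F (e k) else 0)%:E)%E.
    rewrite /u; case: ifPn => [/andP[Dk rk]|_]; last by rewrite integral_probability_cst.
    under eq_integral do rewrite EFinM.
    rewrite ge0_integralZl_EFin ?sqr_ge0//; last 2 first.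
    - by move=> X _; rewrite lee_fin; case: ifP.
    - by apply/measurable_EFinP; exact: mind.
    rewrite /F [X in (_ <= X)%E]EFinM lee_wpmul2l ?lee_fin ?sqr_ge0// -QE; last 2 first.
    - by apply/measurable_EFinP; exact: mind.
    - by move=> X; rewrite lee_fin; case: ifP.
    have r_ge : eta <= r by rewrite ler_peMr ?(ltW eta0)// exprn_ege1// ler1n.
    have rpos : 0 < r by exact: lt_le_trans r_ge.
    apply: (@score_error _ _ _ eps) => //.
    - exact: lt_trans rk.
    - apply: le_trans (ltW rk); rewrite -mulrA mulrC /r.
      apply: ler_pM; rewrite ?mulr_ge0 ?exprn_ge0 ?(ltW s0)//; first by case/andP: e64.
      by apply: ler_weXn2l => //; rewrite ler1n.
    - apply: le_trans (ltW rk); apply: (@le_trans _ _ (4 * (eta / 2))).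
        by rewrite ler_pM2l.
      rewrite /r mulrCA ler_pM2l// -natrX; lra.
  apply: (@le_trans _ _ (\sum_(0 <= k < m) (if act k then F (e k) else 0)%:E)%E).
    by apply: lee_sum => k _; exact: ik.
  rewrite sumEFin lee_fin.
  pose s := [seq e k | k <- iota 0 m & D k].
  have sG x : x \in s -> G x.
    by move=> /mapP[k]; rewrite mem_filter => /andP[Dk _] ->; exact: DG.
  have us : uniq s.
    rewrite map_inj_in_uniq ?filter_uniq ?iota_uniq// => j k.
    by rewrite !mem_filter => /andP[Dj _] /andP[Dk _]; exact: einj.
  apply: le_trans (separated_shell_sum eta0 s0 w12 N12 Nw count (GK _ Gg0) us _ (sepG _ sG)); last first.
    by move=> x /sG/GK.
  by rewrite big_map big_filter_cond -big_mkcond/= /index_iota subn0.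
apply: (@le_trans _ _ (2%:E * ((r ^+ 2)%:E + (2 ^+ 47 * eta ^+ 2)%:E) + (5 * eta ^+ 2)%:E)%E).
  by rewrite leeD2r// lee_wpmul2l ?lee_fin// leeD2l.
rewrite -!EFinD lee_fin /r exprMn -exprM.
have -> : 2 * (eta ^+ 2 * 2 ^+ (22 * 2) + 2 ^+ 47 * eta ^+ 2) + 5 * eta ^+ 2 =
  (2 ^+ 45 + 2 ^+ 48 + 5) * eta ^+ 2 by ring.
rewrite ler_wpM2r ?sqr_ge0//.
have -> : (2 : RR) ^+ 49 = 2 ^+ 45 + 2 ^+ 48 + (2 ^+ 48 - 2 ^+ 45) by ring.
rewrite lerD2l; have -> : (2 : RR) ^+ 48 - 2 ^+ 45 = 7 * 2 ^+ 45 by ring.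
apply: (@le_trans _ _ (7 * 1)); first by lra.
by rewrite ler_pM2l// exprn_ege1// ler1n.
Qed.

End upper_bound.

(** * Lower bound from contamination *)

Section symmetric_noise_intro.
Context (n : nat) (sigma : RR) (P : probability (vec n) RR).

Lemma Xi_sym_intro :
  (forall A, measurable A -> P (@vopp n @^-1` A) = P A) ->
  (forall w, \int[P]_x (dot w x ^+ 2)%:E <= (sigma ^+ 2 * sqnorm w)%:E)%E ->
  Xi_sym sigma P.
Proof.
move=> sym dot2.
have mc i : measurable_fun setT (fun x : vec n => coord x i : mR).
  exact: measurable_tnth.
have int2 i : P.-integrable setT (fun x : vec n => (coord x i ^+ 2)%:E).
  apply/integrableP; split.
    by apply/measurable_EFinP; apply: measurable_funX; exact: mc.
  pose w : vec n := [tuple ((i == j)%:R : mR) | j < n].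
  have dw x : dot w x = coord x i.
    rewrite /dot (bigD1 i)//= coord_mktuple eqxx mul1r big1 ?addr0// => j.
    by rewrite eq_sym coord_mktuple => /negPf ->; rewrite mul0r.
  apply: (@le_lt_trans _ _ (sigma ^+ 2 * sqnorm w)%:E); last exact: ltry.
  apply: le_trans (dot2 w); rewrite le_eqVlt; apply/orP; left; apply/eqP.
  by apply: eq_integral => x _; rewrite dw /= ger0_norm// sqr_ge0.
have int1 i : P.-integrable setT (fun x : vec n => (coord x i)%:E).
  have i1 : P.-integrable setT (fun x : vec n => 1%:E).
    by apply: finite_measure_integrable_cst.
  apply: (le_integrable _ _ _ (integrableD _ i1 (int2 i))) => //.
    by apply/measurable_EFinP; exact: mc.
  move=> x _; rewrite lee_fin [leRHS]ger0_norm ?addr_ge0 ?sqr_ge0//.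
  rewrite -(real_normK (num_real (coord x i))).
  by have := sqr_ge0 (`|coord x i| - 1); rewrite sqrrB1; have := normr_ge0 (coord x i); lra.
have mean0 i : Defs.mean P i = 0.
  have mopp : measurable_fun setT (@vopp n) by apply: measurable_vopp.
  have e1 : (\int[P]_x (coord x i)%:E = \int[P]_x (- (coord x i)%:E))%E.
    transitivity (\int[pushforward P (@vopp n)]_x (coord x i)%:E)%E.
      by apply: eq_measure_integral => //= A mA _; rewrite /pushforward sym.
    rewrite integral_pushforward//=.
    - by apply: eq_integral => x _ /=; rewrite coordN EFinN.
    - by apply/measurable_EFinP; exact: mc.
    - rewrite preimage_setT (_ : _ \o _ = fun x => - (coord x i)%:E)%E.
        exact: integrableN.
      by apply/funext => x /=; rewrite coordN EFinN.
  rewrite integralN in e1; last by apply: integrable_add_def.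
  rewrite /Defs.mean; have : (\int[P]_x (coord x i)%:E)%E \is a fin_num.
    exact: integrable_fin_num.
  move: e1; case: (\int[P]_x _)%E => // r [rr] _ /=; lra.
split=> // v; pose w : vec n := [tuple (v i : mR) | i < n].
have wE i : coord w i = v i by rewrite coord_mktuple.
have := dot2 w; rewrite integral_dot_sqr// lee_fin -subr_ge0.
have -> : \sum_(i < n) \sum_(j < n) v i *
    ((if i == j then sigma ^+ 2 else 0) - covariance P i j) * v j =
  \sum_(i < n) \sum_(j < n) coord w i *
    ((if i == j then sigma ^+ 2 else 0) - covariance P i j) * coord w j.
  by apply: eq_bigr => i _; apply: eq_bigr => j _; rewrite !wE.
rewrite quadratic_form_subE; congr (0 <= _ - _).
apply: eq_bigr => i _; apply: eq_bigr => j _; congr (_ * fine _).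
by apply: eq_integral => x _; rewrite !mean0 !subr0.
Qed.

End symmetric_noise_intro.

Lemma uniform_probability_ex {d} {T : measurableType d} M (a : 'I_M.+1 -> T) :
  exists P : probability T RR, forall f, measurable_fun setT f ->
    (forall x, 0 <= f x)%E ->
    (\int[P]_x f x = \sum_(j < M.+1) (M.+1%:R^-1)%:E * f (a j))%E.
Proof.
have c0 : 0 <= M.+1%:R^-1 :> RR by rewrite invr_ge0.
pose m0 : {measure set T -> \bar RR} :=
  msum (fun k => \d_(a (inord k)) : {measure set T -> \bar RR}) M.+1.
have m1 : mscale (NngNum c0) m0 setT = 1%E.
  rewrite /mscale/= /m0 /msum/=; under eq_bigr do rewrite diracT.
  by rewrite sumEFin -EFinM sumr_const card_ord mulVf.
pose P : probability T RR := HB.pack (mscale (NngNum c0) m0)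
  (Measure_isProbability.Build _ _ _ (mscale (NngNum c0) m0) m1).
exists P => f mf f0.
rewrite [LHS](_ : _ = \int[mscale (NngNum c0) m0]_x f x)%E//.
rewrite ge0_integral_mscale// ge0_integral_measure_sum//= ge0_sume_distrr//; last first.
  by move=> i _; apply: integral_ge0.
by apply: eq_bigr => i _; rewrite integral_dirac// diracT mul1e inord_val.
Qed.

Section contamination_lower_bound.
Context (n N : nat).
Implicit Types (K : set (vec n)) (x y v : vec n).

Lemma adversary_id (eps : RR) : 0 <= eps -> adversary eps (@id (sample n N)).
Proof.
move=> e0; split=> // X; rewrite card_classical_setE big1 ?mulr_ge0// => i _.
by rewrite eqxx.
Qed.

Definition lattice_atom M v (j : 'I_(2 * M).+1) : vec n := vscale (j%:R - M%:R) v.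

Lemma lattice_noise_ex (sigma : RR) M v : 0 <= sigma ->
  M%:R ^+ 2 * sqnorm v <= sigma ^+ 2 ->
  exists P : probability (vec n) RR, Xi_sym sigma P /\
    forall f, measurable_fun setT f -> (forall x, 0 <= f x)%E ->
      (\int[P]_x f x = \sum_(j < (2 * M).+1) ((2 * M).+1%:R^-1)%:E * f (lattice_atom v j))%E.
Proof.
move=> s0 Mv; have [P PE] := uniform_probability_ex (@lattice_atom M v).
exists P; split=> //; apply: Xi_sym_intro => [A mA|w].
  have mopp : measurable_fun setT (@vopp n) by apply: measurable_vopp.
  have mA' : measurable (@vopp n @^-1` A).
    by rewrite -[X in measurable X]setTI; exact: mopp.
  have ind B : measurable B -> P B = (\sum_(j < (2 * M).+1)
      ((2 * M).+1%:R^-1)%:E * (\1_B (lattice_atom v j))%:E)%E.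
    move=> mB; transitivity (\int[P]_x (\1_B x)%:E)%E; first by rewrite integral_indic ?setIT.
    by apply: PE => [|z]; [exact/measurable_EFinP|rewrite lee_fin].
  rewrite !ind// (reindex_inj rev_ord_inj)/=; apply: eq_bigr => j _; congr (_ * _%:E)%E.
  rewrite !indicE; congr (_ %:R); congr (nat_of_bool _).
  have e : vopp (lattice_atom v (rev_ord j)) = lattice_atom v j.
    apply: vec_ext => i; rewrite !coordE /= subSS natrB ?natrM; last by rewrite -ltnS.
    by ring.
  by apply/idP/idP; rewrite !inE /= e.
rewrite PE; last by move=> x; rewrite lee_fin sqr_ge0.
  apply: (@le_trans _ _ (\sum_(j < (2 * M).+1) ((2 * M).+1%:R^-1 * (sigma ^+ 2 * sqnorm w))%:E)%E).
    apply: lee_sum => j _; rewrite -EFinM lee_fin ler_wpM2l//.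
    rewrite dotZr exprMn; apply: (@le_trans _ _ (M%:R ^+ 2 * (sqnorm w * sqnorm v))).
      rewrite ler_pM ?sqr_ge0 ?cauchy_schwarz//.
      rewrite -ler_sqrt ?sqr_ge0// !sqrtr_sqr [leRHS]ger0_norm// ler_norml.
      have := leq_ord j; rewrite -(ler_nat RR) natrM => h.
      by have := ler0n RR j; lra.
    rewrite (mulrC (sqnorm w)) mulrA ler_wpM2r ?sqnorm_ge0//.
  by rewrite sumEFin lee_fin sumr_const card_ord -[leLHS]mulr_natl mulrA mulfV// mul1r.
by apply/measurable_EFinP; apply: measurable_funX; apply: measurable_dot.
Qed.

(* With noise uniform on a lattice of about 1 / eps atoms spaced by y - x, the
   clean samples around x and around y differ in one atom only: moving the top
   atom around y to the bottom atom around x turns the second law into the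
   first. By Markov's inequality this stays within the budget with probability
   at least 3 / 4, even when [eps * N < 1]. *)
Lemma lower_contamination K (sigma eps : RR) x y : (0 < N)%N -> 0 < sigma ->
  0 < eps <= 1 -> K x -> K y -> 0 < dist x y -> 3 * dist x y <= sigma * eps ->
  ((dist x y ^+ 2 / 8)%:E <= minimax_sym N K sigma eps)%E.
Proof.
move=> N0 s0 /andP[e0 e1] Kx Ky xy0 xye.
pose v := vsub y x; pose M := (Num.truncn (2 / eps)).+1.
have d0 : 0 < dist x y ^+ 2 by rewrite exprn_gt0.
have ie : 0 <= 2 / eps by rewrite divr_ge0// ltW.
have Mlo : 2 / eps < M%:R by exact: truncnS_gt.
have Mhi : M%:R <= 3 / eps.
  rewrite -[M%:R]natr1; have h : (Num.truncn (2 / eps))%:R <= 2 / eps by rewrite truncn_le.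
  have h3 : 1 <= 1 / eps by rewrite ler_pdivlMr// mul1r.
  have -> : 3 / eps = 2 / eps + 1 / eps by field; rewrite gt_eqF.
  by rewrite lerD.
have sv : sqnorm v = dist x y ^+ 2 by rewrite sqr_dist -sqnormN -vsubC.
have Mv : M%:R ^+ 2 * sqnorm v <= sigma ^+ 2.
  rewrite sv -exprMn ler_pXn2r ?nnegrE ?mulr_ge0 ?dist_ge0 ?(ltW s0)//.
  apply: (@le_trans _ _ (3 / eps * dist x y)); first by rewrite ler_wpM2r ?dist_ge0.
  by rewrite mulrAC ler_pdivrMr.
have [P [PXi PE]] := lattice_noise_ex (ltW s0) Mv.
apply: le_ereal_inf_tmp => _ [muhat mmu <-]; set W := worst_risk _ _ _ _.
pose top := vadd y (lattice_atom v (@ord_max (2 * M))).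
pose bot := vadd x (@lattice_atom M v ord0).
pose T z := if z == top then bot else z.
have bot_top : bot != top.
  apply/eqP => bt; move: d0; rewrite -sv.
  have : vscale ((2 * M).+1%:R) v = vzero n.
    apply: vec_ext => i; have := congr1 (fun z => coord z i) bt.
    rewrite /bot /top /lattice_atom /v !coordE /= -natr1 => h; lra.
  move/(congr1 (@sqnorm n)); rewrite sqnormZ => /eqP.
  by rewrite sqnorm0 mulf_eq0 expf_eq0/= pnatr_eq0/= => /eqP ->; rewrite ltxx.
have atom_top (j : 'I_(2 * M).+1) : (vadd y (lattice_atom v j) == top) = (j == ord_max).
  apply/eqP/eqP => [h|->//]; apply/val_inj => /=.
  have : vscale (j%:R - (2 * M)%:R) v = vzero n.
    apply: vec_ext => k; have := congr1 (fun z => coord z k) h.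
    rewrite /top /lattice_atom !coordE /= => h'; rewrite mulrBl.
    by move: (coord v k) h' => t; lra.
  move/(congr1 (@sqnorm n)); rewrite sqnormZ sqnorm0 sv => /eqP.
  rewrite mulf_eq0 (gt_eqF d0) orbF expf_eq0/= subr_eq0 eqr_nat.
  by move/eqP.
pose cnt (X : sample n N) : RR := \sum_(i < N) (tnth X i == top)%:R.
pose mapT (X : sample n N) : sample n N := [tuple T (tnth X i) | i < N].
pose C X := if cnt X <= eps * N%:R then mapT X else X.
have mtop : measurable_fun setT (fun z : vec n => z == top).
  apply: (measurable_fun_bool true); rewrite setTI.
  rewrite (_ : _ @^-1` _ = [set top]); first exact: measurable_vec1.
  by apply/seteqP; split=> z /= => [/eqP|->]; rewrite ?eqxx.
have mT : measurable_fun setT T by apply: measurable_fun_ifT.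
have mmapT : measurable_fun setT mapT.
  apply/measurable_fun_tnthP => i.
  rewrite (_ : _ \o _ = fun X => T (tnth X i)); last first.
    by apply/funext => X /=; rewrite tnth_mktuple.
  exact: (measurableT_comp mT (measurable_tnth i)).
have mtopi i : measurable_fun setT (fun X : sample n N => (tnth X i == top)%:R : mR).
  rewrite (_ : (fun _ => _) = (fun X : sample n N => if tnth X i == top then 1 else 0)).
    by apply: measurable_fun_ifT => //; exact: (measurableT_comp mtop (measurable_tnth i)).
  by apply/funext => X; case: eqP.
have mcnt : measurable_fun setT (cnt : _ -> mR) by apply: measurable_sum => i; exact: mtopi.
have aC : adversary eps C.
  split.
    by apply: measurable_fun_ifT => //; apply: measurable_fun_ler.
  move=> X; rewrite card_classical_setE /C; case: ifPn => [h|_]; last first.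
    by rewrite big1 ?mulr_ge0 ?(ltW e0)// => i _; rewrite eqxx.
  apply: le_trans h; apply: ler_sum => i _; rewrite tnth_mktuple /T.
  by case: ifP => _; [case: (_ != _)|rewrite eqxx].
pose F X := (sqnorm (vsub (muhat X) x))%:E.
pose F1 X := (sqnorm (vsub (muhat X) y))%:E.
have mF : measurable_fun setT F.
  by apply/measurable_EFinP; apply: measurable_sqnorm; apply: measurable_vsub.
have mF1 : measurable_fun setT F1.
  by apply/measurable_EFinP; apply: measurable_sqnorm; apply: measurable_vsub.
have R0W : (iid_expect P (fun xi => F (shift_sample x xi)) <= W)%E.
  apply: ereal_sup_ubound; exists x, P, id; split=> //.
  exact: adversary_id (ltW e0).
have R1W : (iid_expect P (fun xi => F1 (C (shift_sample y xi))) <= W)%E.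
  by apply: ereal_sup_ubound; exists y, P, C; split.
pose tau z := vsub (T (vadd y z)) x.
have mtau : measurable_fun setT tau.
  apply: measurable_vsub => //; apply: (measurableT_comp mT); exact: measurable_vadd.
have tauP f : measurable_fun setT f -> (forall z, 0 <= f z)%E ->
    (\int[P]_z f (tau z) = \int[P]_z (f z * 1%:E))%E.
  move=> mf f0; under [RHS]eq_integral do rewrite mule1.
  rewrite !PE//; last exact: (measurableT_comp mf mtau).
  rewrite [RHS](reindex_inj (@ordS_inj _))/=; apply: eq_bigr => j _; congr (_ * f _)%E.
  rewrite /tau /T; apply: vec_ext => i.
  have [jmax|jmax] := eqVneq j ord_max.
    rewrite jmax eqxx /bot /lattice_atom !coordE /= modnn; ring.
  rewrite atom_top (negPf jmax).
  rewrite !coordE /= modn_small; last first.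
    by rewrite ltn_neqAle ltn_ord andbT eqSS.
  by rewrite -[j.+1%:R]natr1 /v ?coordE; ring.
have E0 : iid_expect P (fun xi => F (shift_sample x xi)) =
          iid_expect P (fun xi => F (mapT (shift_sample y xi))).
  have mFx : measurable_fun setT (fun xi => F (shift_sample x xi)).
    exact: (measurableT_comp mF (@measurable_shift_sample _ _ x)).
  transitivity (iid_expect P (fun xi => F (shift_sample x xi) * (\prod_(i < N) 1%R)%:E)%E).
    by apply: eq_iid_expect => xi; rewrite big1// mule1.
  rewrite -(@iid_expect_change _ _ P N (fun=> tau) (fun _ _ => 1)
    (fun xi => F (shift_sample x xi)))//; last by move=> z; rewrite lee_fin sqnorm_ge0.
  apply: eq_iid_expect => xi; congr F; apply: eq_from_tnth => i.
  rewrite !tnth_mktuple; apply: vec_ext => k; rewrite /tau !coordE addrC subrK.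
  by congr (coord (T _) _).
pose c := dist x y ^+ 2 / 2.
have c0 : 0 <= c by rewrite divr_ge0// ltW.
have eN : 0 < eps * N%:R by rewrite mulr_gt0// ltr0n.
have pw xi : (c%:E <= F1 (C (shift_sample y xi)) + F (mapT (shift_sample y xi)) +
    (c / (eps * N%:R))%:E * (cnt (shift_sample y xi))%:E)%E.
  have cnt0 : 0 <= cnt (shift_sample y xi) by apply: sumr_ge0.
  rewrite /C; case: ifPn => [_|].
    rewrite -EFinM -!EFinD lee_fin; set z := muhat _.
    apply: (@le_trans _ _ (sqnorm (vsub z y) + sqnorm (vsub z x))); last first.
      by rewrite lerDl mulr_ge0// divr_ge0// ltW.
    rewrite /c sqr_dist.
    have -> : vsub x y = vsub (vsub z y) (vsub z x).
      by apply: vec_ext => i; rewrite !coordE; ring.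
    move: (vsub z y) (vsub z x) => a b.
    have := sqnorm_ge0 (vadd a b).
    by rewrite !sqnormE !dotE (dotC b a); lra.
  rewrite -ltNge => big; rewrite -EFinM -!EFinD lee_fin.
  apply: (@le_trans _ _ (c / (eps * N%:R) * cnt (shift_sample y xi))).
    by rewrite mulrAC ler_pdivlMr// ler_wpM2l// ltW.
  by rewrite lerDr addr_ge0 ?sqnorm_ge0.
have [Q QE] := iid_expect_probability P N.
have msh := @measurable_shift_sample n N y.
have m1 : measurable_fun setT (fun xi => F1 (C (shift_sample y xi))).
  exact: (measurableT_comp mF1 (measurableT_comp aC.1 msh)).
have m2 : measurable_fun setT (fun xi => F (mapT (shift_sample y xi))).
  exact: (measurableT_comp mF (measurableT_comp mmapT msh)).
have m3 : measurable_fun setT (fun xi => (cnt (shift_sample y xi))%:E).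
  by apply/measurable_EFinP; exact: (measurableT_comp mcnt msh).
have cnt0 xi : (0 <= (cnt (shift_sample y xi))%:E)%E by rewrite lee_fin sumr_ge0.
have cN0 : 0 <= c / (eps * N%:R) by rewrite divr_ge0// ltW.
have Icnt : (\int[Q]_xi (cnt (shift_sample y xi))%:E <= (eps * N%:R / 4)%:E)%E.
  pose g z : \bar RR := ((vadd y z == top)%:R)%:E.
  have mg : measurable_fun setT g.
    apply/measurable_EFinP.
    rewrite (_ : (fun _ => _) = (fun z => if vadd y z == top then 1 else 0)).
      apply: measurable_fun_ifT => //; apply: (measurableT_comp mtop).
      exact: measurable_vadd.
    by apply/funext => z; case: eqP.
  have g0 z : (0 <= g z)%E by rewrite lee_fin.
  have Ig : (\int[P]_z g z = ((2 * M).+1%:R^-1)%:E)%E.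
    rewrite PE// (bigD1 ord_max)//= big1 ?adde0 => [|j jm].
      by rewrite /g atom_top eqxx mule1.
    by rewrite /g atom_top (negPf jm) mule0.
  rewrite (_ : (\int[Q]_xi _)%E = (\sum_(i < N) \int[Q]_xi g (tnth xi i))%E); last first.
    rewrite -ge0_integral_sum//; last first.
      by move=> i; exact: (measurableT_comp mg (measurable_tnth i)).
    apply: eq_integral => xi _; rewrite /cnt -sumEFin; apply: eq_bigr => i _.
    by rewrite tnth_mktuple.
  under eq_bigr => i _.
    rewrite -QE//; last exact: (measurableT_comp mg (measurable_tnth i)).
    rewrite iid_expect_tnth// Ig.
    over.
  rewrite sumEFin lee_fin sumr_const card_ord -[leLHS]mulr_natr mulrC (mulrC eps) -mulrA.
  rewrite ler_wpM2l// -[leRHS]invrK lef_pV2 ?posrE ?ltr0n ?invr_gt0 ?divr_gt0//.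
  rewrite invf_div -[(2 * M).+1%:R]natr1 natrM; apply: (@le_trans _ _ (2 * M%:R)); last by rewrite lerDl.
  rewrite (_ : 4 / eps = 2 * (2 / eps)); first by rewrite ler_pM2l// ltW.
  by field; rewrite gt_eqF.
have total : (c%:E <= \int[Q]_xi F1 (C (shift_sample y xi)) +
    \int[Q]_xi F (mapT (shift_sample y xi)) + (c / 4)%:E)%E.
  rewrite -[leLHS](integral_probability_cst Q).
  apply: (@le_trans _ _ (\int[Q]_xi (F1 (C (shift_sample y xi)) + F (mapT (shift_sample y xi)) +
    (c / (eps * N%:R))%:E * (cnt (shift_sample y xi))%:E))%E).
    apply: ge0_le_integral => //.
    by apply: emeasurable_funD; [exact: emeasurable_funD|exact: measurable_funeM].
  rewrite ge0_integralD//; last 4 first.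
  - by move=> xi _; rewrite adde_ge0 ?lee_fin ?sqnorm_ge0.
  - exact: emeasurable_funD.
  - by move=> xi _; rewrite mule_ge0.
  - exact: measurable_funeM.
  rewrite ge0_integralD//; last 2 first.
  - by move=> xi _; rewrite lee_fin sqnorm_ge0.
  - by move=> xi _; rewrite lee_fin sqnorm_ge0.
  rewrite leeD2l// ge0_integralZl_EFin//.
  apply: (@le_trans _ _ ((c / (eps * N%:R))%:E * (eps * N%:R / 4)%:E)%E).
    by rewrite lee_wpmul2l.
  rewrite -EFinM lee_fin le_eqVlt; apply/orP; left; apply/eqP.
  have N1 : N%:R != 0 :> RR by rewrite pnatr_eq0 -lt0n.
  have e2 : eps != 0 by rewrite gt_eqF.
  by field; rewrite ?N1 ?e2.
rewrite -!QE// -?E0 in total; last 2 first.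
- by move=> xi; rewrite lee_fin sqnorm_ge0.
- by move=> xi; rewrite lee_fin sqnorm_ge0.
have {}total := le_trans total (leeD2r _ (leeD R1W R0W)).
have -> : dist x y ^+ 2 / 8 = c / 4 by rewrite /c; field.
move: total; case: W {R0W R1W} => [r|_|/=].
- by rewrite -!EFinD !lee_fin; lra.
- exact: leey.
- by rewrite addNye leeNy_eq.
Qed.

End contamination_lower_bound.

(** * Lower bound from packings *)

Section gaussian_line.
Context (s : RR) (s0 : 0 < s).
Local Notation lambda := (@lebesgue_measure RR).
Implicit Types (f : mR -> \bar RR) (t : RR).

Lemma ge0_integral_normal f : measurable_fun setT f -> (forall x, 0 <= f x)%E ->
  (\int[normal_prob 0 s]_x f x = \int[lambda]_x (f x * (normal_pdf 0 s x)%:E))%E.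
Proof.
move=> mf f0.
have numu : normal_prob 0 s `<< lambda := normal_prob_dominates 0 s.
rewrite -(Radon_Nikodym_SigmaFinite.change_of_variables numu f0 measurableT mf).
have mp : measurable_fun setT (fun x : mR => (normal_pdf 0 s x)%:E).
  by apply/measurable_EFinP; exact: measurable_normal_pdf.
have ig := Radon_Nikodym_SigmaFinite.f_integrable numu.
apply: ae_eq_integral => //.
- by apply: emeasurable_funM => //; exact: measurable_int ig.
- exact: emeasurable_funM.
apply: ae_eqe_mul2l; apply: integral_ae_eq => //.
by move=> A _ mA; rewrite -Radon_Nikodym_SigmaFinite.f_integral.
Qed.

Lemma lebesgue_integral_shift f t : measurable_fun setT f -> (forall x, 0 <= f x)%E ->
  (\int[lambda]_x f ((x : RR) + t)%R = \int[lambda]_x f x)%E.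
Proof.
move=> mf f0.
have mt : measurable_fun setT (fun x : mR => ((x : RR) + t : mR)).
  by apply: measurable_funD.
transitivity (\int[pushforward lambda (fun x : mR => ((x : RR) + t)%R : mR)]_x f x)%E.
  by rewrite ge0_integral_pushforward.
apply: eq_measure_integral => A mA _.
rewrite -lebesgue_measure_unique// => _ [[a b] /= ab <-].
rewrite /pushforward (_ : _ @^-1` _ = `]a - t, b - t]%classic).
  rewrite !lebesgue_measure_itv/= !lte_fin ltrD2r; case: ifP => // _.
  by rewrite -!EFinB; congr (_%:E); ring.
by apply/seteqP; split=> x /=; rewrite !in_itv/= ltrBlDr lerBrDr.
Qed.

Lemma lebesgue_integral_opp f : measurable_fun setT f -> (forall x, 0 <= f x)%E ->
  (\int[lambda]_x f (- (x : RR))%R = \int[lambda]_x f x)%E.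
Proof.
move=> mf f0.
have mt : measurable_fun setT (fun x : mR => (- (x : RR) : mR)) by apply: measurable_funN.
transitivity (\int[pushforward lambda (fun x : mR => (- (x : RR))%R : mR)]_x f x)%E.
  by rewrite ge0_integral_pushforward.
by apply: eq_measure_integral => A mA _; exact: (lebesgue_measureN mA).
Qed.

Definition gauss_ratio t (x : RR) : RR := expR (t * x / s ^+ 2 - t ^+ 2 / (2 * s ^+ 2)).

Lemma measurable_gauss_ratio t : measurable_fun setT (gauss_ratio t : mR -> mR).
Proof.
apply: measurable_expRf; apply: measurable_funB => //.
by apply: measurable_funM => //; apply: measurable_funM.
Qed.

Lemma normal_pdf_shift t (x : RR) : normal_pdf 0 s (x - t) = gauss_ratio t x * normal_pdf 0 s x.
Proof.
rewrite normal_pdfE ?gt_eqF//= /normal_fun /gauss_ratio mulrCA -expRD.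
by congr (_ * expR _); rewrite !subr0 -mulr_natr; field; rewrite gt_eqF.
Qed.

Lemma normal_shift f t : measurable_fun setT f -> (forall x, 0 <= f x)%E ->
  (\int[normal_prob 0 s]_x f ((x : RR) + t)%R =
   \int[normal_prob 0 s]_x (f x * (gauss_ratio t x)%:E))%E.
Proof.
move=> mf f0.
have mft : measurable_fun setT (fun x : mR => f ((x : RR) + t)%R).
  by apply: (measurableT_comp mf); apply: measurable_funD.
have ml : measurable_fun setT (fun x : mR => (gauss_ratio t x)%:E).
  by apply/measurable_EFinP; exact: measurable_gauss_ratio.
have mp u : measurable_fun setT (fun x : mR => (normal_pdf 0 s ((x : RR) + u)%R)%:E).
  apply/measurable_EFinP; apply: (measurableT_comp (@measurable_normal_pdf _ _ _)).
  exact: measurable_funD.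
rewrite !ge0_integral_normal//; last 2 first.
- exact: emeasurable_funM.
- by move=> x; rewrite mule_ge0// lee_fin expR_ge0.
under [RHS]eq_integral => x _ do rewrite -muleA -EFinM -normal_pdf_shift.
rewrite -(lebesgue_integral_shift (f := fun x => f x * (normal_pdf 0 s ((x : RR) - t)%R)%:E)%E t).
- by apply: eq_integral => x _; rewrite addrK.
- exact: emeasurable_funM.
- by move=> x; rewrite mule_ge0// lee_fin normal_pdf_ge0.
Qed.

Lemma normal_opp f : measurable_fun setT f -> (forall x, 0 <= f x)%E ->
  (\int[normal_prob 0 s]_x f (- (x : RR))%R = \int[normal_prob 0 s]_x f x)%E.
Proof.
move=> mf f0.
have mfo : measurable_fun setT (fun x : mR => f (- (x : RR))%R).
  by apply: (measurableT_comp mf); apply: measurable_funN.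
have mp : measurable_fun setT (fun x : mR => (normal_pdf 0 s x)%:E).
  by apply/measurable_EFinP; exact: measurable_normal_pdf.
rewrite !ge0_integral_normal//.
rewrite -(lebesgue_integral_opp (f := fun x => f x * (normal_pdf 0 s x)%:E)%E).
- apply: eq_integral => x _; congr (_ * _%:E)%E.
  by rewrite !normal_pdfE ?gt_eqF//= /normal_fun !subr0 sqrrN.
- exact: emeasurable_funM.
- by move=> x; rewrite mule_ge0// lee_fin normal_pdf_ge0.
Qed.

End gaussian_line.

Section gaussian_noise.
Context (n : nat).
Implicit Types (x theta : vec n).

Definition likelihood (s : RR) theta x : RR :=
  expR (dot theta x / s ^+ 2 - sqnorm theta / (2 * s ^+ 2)).

Lemma measurable_likelihood s theta :
  measurable_fun setT (fun x => likelihood s theta x : mR).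
Proof.
apply: measurable_expRf; apply: measurable_funB => //; apply: measurable_funM => //.
exact: measurable_dot.
Qed.

Lemma likelihood_ge0 s theta x : 0 <= likelihood s theta x.
Proof. exact: expR_ge0. Qed.

Lemma likelihood_sqr s theta x : 0 < s ->
  likelihood s theta x ^+ 2 =
  expR (sqnorm theta / s ^+ 2) * likelihood s (vscale 2 theta) x.
Proof.
move=> s0; rewrite /likelihood -expRM_natl -expRD sqnormZ dotZl.
by congr expR; field; rewrite gt_eqF.
Qed.

Lemma gaussian_noise_ex (s : RR) : 0 < s -> exists P : probability (vec n) RR,
  (forall A, measurable A -> P (@vopp n @^-1` A) = P A) /\
  (forall theta f, measurable_fun setT f -> (forall x, 0 <= f x)%E ->
    (\int[P]_x f (vadd theta x) = \int[P]_x (f x * (likelihood s theta x)%:E))%E).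
Proof.
move=> s0; have [P PE] := iid_expect_probability (normal_prob 0 s) n.
exists P; split=> [A mA|theta f mf f0].
  have mopp : measurable_fun setT (@vopp n) by apply: measurable_vopp.
  have mA' : measurable (@vopp n @^-1` A).
    by rewrite -[X in measurable X]setTI; exact: mopp.
  have ind B : measurable B ->
      P B = iid_expect (normal_prob 0 s) (fun x : vec n => (\1_B x)%:E).
    move=> mB; rewrite PE; first by rewrite integral_indic ?setIT.
    - exact/measurable_EFinP.
    - by move=> x; rewrite lee_fin.
  rewrite !ind//.
  transitivity (iid_expect (normal_prob 0 s) (fun x : vec n =>
      (\1_A x)%:E * (\prod_(i < n) 1%R)%:E)%E); last first.
    by apply: eq_iid_expect => x; rewrite big1// mule1.
  rewrite -(@iid_expect_change _ _ (normal_prob 0 s) n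
      (fun _ (x : mR) => (- (x : RR) : mR)) (fun _ _ => 1) (fun x : vec n => (\1_A x)%:E))//.
  - by move=> _; apply: measurable_funN.
  - move=> _ g mg g0; rewrite normal_opp//.
    by apply: eq_integral => x _; rewrite mule1.
  - exact/measurable_EFinP.
have mfx : measurable_fun setT (fun x => f (vadd theta x)).
  by apply: (measurableT_comp mf); exact: measurable_vadd.
have ml : measurable_fun setT (fun x => (likelihood s theta x)%:E).
  by apply/measurable_EFinP; exact: measurable_likelihood.
rewrite -!PE//; last 2 first.
- exact: emeasurable_funM.
- by move=> x; rewrite mule_ge0// lee_fin likelihood_ge0.
transitivity (iid_expect (normal_prob 0 s) (fun x : vec n =>
    f x * (\prod_(i < n) gauss_ratio s (coord theta i) (tnth x i))%:E)%E).
  rewrite -(@iid_expect_change _ _ (normal_prob 0 s) n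
      (fun i (x : mR) => ((x : RR) + coord theta i : mR))
      (fun i => gauss_ratio s (coord theta i)) f)//.
  - apply: eq_iid_expect => x; congr f; apply: vec_ext => i.
    by rewrite coordD addrC coord_mktuple.
  - by move=> i; apply: measurable_funD.
  - by move=> i; exact: measurable_gauss_ratio.
  - by move=> i x; exact: expR_ge0.
  - by move=> i g mg g0; exact: normal_shift.
apply: eq_iid_expect => x; congr (_ * _%:E)%E; rewrite -expR_sum; congr expR.
by rewrite sumrB -!mulr_suml.
Qed.

Lemma sqr_le_expR (u : RR) : u ^+ 2 <= 2 * (expR u + expR (- u)).
Proof.
wlog u0 : u / 0 <= u => [h|].
  have [u0|/ltW u0] := leP 0 u; first exact: h.
  by have := h (- u); rewrite sqrrN opprK addrC oppr_ge0 => /(_ u0).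
have := expR_ge1Dxn 1 u0; rewrite (_ : 2`! = 2)%N//.
have := expR_gt0 (- u); lra.
Qed.

(* The second moment is bounded through [u ^+ 2 <= 2 * (expR u + expR (- u))],
   as the exponentials are likelihood ratios, which integrate to 1. *)
Lemma gaussian_noise_Xi (sigma s : RR) (P : probability (vec n) RR) :
  0 < s -> 8 * s ^+ 2 <= sigma ^+ 2 ->
  (forall A, measurable A -> P (@vopp n @^-1` A) = P A) ->
  (forall theta f, measurable_fun setT f -> (forall x, 0 <= f x)%E ->
    (\int[P]_x f (vadd theta x) = \int[P]_x (f x * (likelihood s theta x)%:E))%E) ->
  Xi_sym sigma P.
Proof.
move=> s0 s8 sym shift; apply: Xi_sym_intro => // w.
have ml theta : measurable_fun setT (fun x => (likelihood s theta x)%:E).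
  by apply/measurable_EFinP; exact: measurable_likelihood.
have int_l theta : (\int[P]_x (likelihood s theta x)%:E = 1)%E.
  have := shift theta (cst 1%E) (measurable_cst _) (fun=> lee01).
  rewrite integral_probability_cst => ->.
  by apply: eq_integral => x _; rewrite mul1e.
have [w0|w0] := eqVneq (sqnorm w) 0.
  have -> : w = vzero n by exact: sqnorm_eq0.
  under eq_integral => x _.
    rewrite (_ : dot _ _ = 0) ?expr0n; last first.
      by rewrite /dot big1// => i _; rewrite coord0 mul0r.
    over.
  by rewrite integral0 lee_fin sqnorm0 mulr0.
have w_gt0 : 0 < sqnorm w by rewrite lt_neqAle eq_sym w0 sqnorm_ge0.
pose a := Num.sqrt (sqnorm w); have a0 : 0 < a by rewrite sqrtr_gt0.
have a2 : a ^+ 2 = sqnorm w by rewrite sqr_sqrtr// ltW.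
pose theta := vscale (s / a) w.
have th : sqnorm theta = s ^+ 2.
  by rewrite sqnormZ -a2; field; rewrite gt_eqF.
pose e := expR (1 / 2 : RR).
have e2 : e <= 2 by apply: (le_trans (@expR_le_quad _ _)); rewrite ?expr2; lra.
have bnd x : dot w x ^+ 2 <= 4 * (a * s) ^+ 2 *
    (likelihood s theta x + likelihood s (vopp theta) x).
  pose u := dot theta x / s ^+ 2.
  have -> : dot w x ^+ 2 = (a * s) ^+ 2 * u ^+ 2.
    by rewrite /u dotZl; field; rewrite !gt_eqF.
  have lE : expR u = e * likelihood s theta x.
    by rewrite /likelihood th -expRD; congr expR; rewrite /u; field; rewrite gt_eqF.
  have lE' : expR (- u) = e * likelihood s (vopp theta) x.
    rewrite /likelihood sqnormN dotNl th -expRD; congr expR.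
    by rewrite /u; field; rewrite gt_eqF.
  have := sqr_le_expR u; rewrite lE lE' => h.
  have l1 := likelihood_ge0 s theta x; have l2 := likelihood_ge0 s (vopp theta) x.
  rewrite [4 * _]mulrC -[leRHS]mulrA ler_wpM2l ?sqr_ge0//; apply: (le_trans h).
  by rewrite -mulrDr; move: (likelihood _ _ _ + _) (addr_ge0 l1 l2) => l ll; nra.
have ms : measurable_fun setT (fun x => (likelihood s theta x +
    likelihood s (vopp theta) x)%:E).
  apply/measurable_EFinP; apply: measurable_funD; exact: measurable_likelihood.
apply: (@le_trans _ _ (\int[P]_x ((4 * (a * s) ^+ 2)%:E * (likelihood s theta x +
    likelihood s (vopp theta) x)%:E))%E).
  apply: ge0_le_integral => //.
  - by move=> x _; rewrite lee_fin sqr_ge0.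
  - by apply/measurable_EFinP; apply: measurable_funX; exact: measurable_dot.
  - exact: measurable_funeM.
  - by move=> x _; rewrite -EFinM lee_fin; exact: bnd.
rewrite ge0_integralZl_EFin//; last 2 first.
- by move=> x _; rewrite lee_fin addr_ge0 ?likelihood_ge0.
- by rewrite mulr_ge0 ?sqr_ge0.
under eq_integral do rewrite EFinD.
rewrite ge0_integralD//; last 2 first.
- by move=> x _; rewrite lee_fin likelihood_ge0.
- by move=> x _; rewrite lee_fin likelihood_ge0.
rewrite !int_l -EFinD -EFinM lee_fin exprMn a2.
have := ler_wpM2r (ltW w_gt0) s8; lra.
Qed.

End gaussian_noise.

Section packing_lower_bound.
Context (n N : nat).
Implicit Types (K : set (vec n)) (x nu theta : vec n).

Lemma sqr_bound_le_sqrt2 (B m : RR) : 0 <= B -> 2 <= m -> B ^+ 2 <= m -> B <= 49 / 64 * m.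
Proof.
move=> B0 m2 Bm; rewrite -[leLHS]ger0_norm// -[leRHS]ger0_norm; last lra.
by rewrite -ler_sqr ?nnegrE// !real_normK ?num_real// exprMn; nra.
Qed.

Lemma packing_arithmetic (a w B S m : RR) : 0 < a -> 0 < B -> 0 < m -> S <= 1 ->
  B <= 49 / 64 * m -> m * a <= m * w + a * (m * (7 / 16) + 4 / 7 * B * S) ->
  a / 8 <= w.
Proof.
move=> a0 B0 m0 S1 Bm h.
have BS : 4 / 7 * B * S <= 7 / 16 * m.
  apply: (@le_trans _ _ (4 / 7 * B)); last lra.
  by rewrite ler_piMr// mulr_ge0// ltW.
have : a * (m * (7 / 16) + 4 / 7 * B * S) <= a * (7 / 8 * m).
  by rewrite ler_pM2l//; lra.
by move=> h2; rewrite -(ler_pM2l m0); lra.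
Qed.

Lemma separated_near_le1 (r : RR) (s : seq (vec n)) z :
  uniq s -> separated (r + r) s -> \sum_(x <- s) (dist z x < r)%R%:R <= 1 :> RR.
Proof.
move=> us sep; pose p x := dist z x < r.
rewrite (eq_bigr (fun x => (p x)%:R : RR))//.
have -> : \sum_(x <- s) (p x)%:R = (size (seq.filter p s))%:R :> RR.
  rewrite size_filter -sum1_count natr_sum [RHS]big_mkcond/=.
  by apply: eq_bigr => x _; case: (p x).
case E : (seq.filter p s) => [|x [|y t]]; rewrite ?ler01 ?lexx//.
have xy : (x \in seq.filter p s) && (y \in seq.filter p s).
  by rewrite E !inE !eqxx orbT.
have := filter_uniq p us; rewrite E /= inE negb_or => /andP[/andP[nxy _] _].
move: xy; rewrite !mem_filter => /andP[/andP[zx xs] /andP[zy ys]].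
have := sep x y xs ys nxy; rewrite ltNge => /negP[].
apply: (le_trans (dist_triangle z _ _)); rewrite lerD// ltW//.
by rewrite dist_sym.
Qed.

(* A chi-square substitute for Fano's inequality: A being the indicator that
   [muhat] is close to x, one has [A * L <= (t * L ^+ 2 + A / t) / 2] for the
   likelihood ratio L, and [L ^+ 2] is again a likelihood ratio up to a constant. *)
Lemma lower_packing K (sigma eps delta : RR) nu (s : seq (vec n)) :
  0 < sigma -> 0 <= eps -> 0 < delta ->
  (forall x, x \in s -> K x /\ dist x nu <= delta) -> uniq s ->
  separated (delta / 2) s -> (2 <= size s)%N ->
  expR (18 * (N%:R * (delta / sigma) ^+ 2)) <= (size s)%:R ->
  (((delta / 4) ^+ 2 / 8)%:E <= minimax_sym N K sigma eps)%E.
Proof.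
move=> sigma0 eps0 delta0 sK us sep s2 sB.
pose tau := sigma / 3; have tau0 : 0 < tau by rewrite divr_gt0.
have tau8 : 8 * tau ^+ 2 <= sigma ^+ 2.
  have -> : 8 * tau ^+ 2 = 8 / 9 * sigma ^+ 2 by rewrite /tau; field.
  by have := sqr_ge0 sigma; lra.
have [P [Psym Pshift]] := gaussian_noise_ex n tau0.
have PXi := gaussian_noise_Xi tau0 tau8 Psym Pshift.
apply: le_ereal_inf_tmp => _ [muhat mmu <-]; set W := worst_risk _ _ _ _.
pose r := delta / 4; have r0 : 0 < r by rewrite divr_gt0.
pose F x X := (sqnorm (vsub (muhat X) x))%:E.
pose A x X : RR := (dist (muhat X) x < r)%R%:R.
pose sh x := @shift_sample n N x.
have msh x : measurable_fun setT (sh x) by exact: measurable_shift_sample.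
have [Q QE] := iid_expect_probability P N.
have mF x : measurable_fun setT (F x).
  by apply/measurable_EFinP; apply: measurable_sqnorm; apply: measurable_vsub.
have mA x : measurable_fun setT (fun X => (A x X)%:E).
  apply/measurable_EFinP.
  rewrite (_ : A x = fun X => if dist (muhat X) x < r then 1 else 0).
    apply: measurable_fun_ifT => //; apply: measurable_fun_ltr => //.
    exact: measurable_dist.
  by apply/funext => X; rewrite /A; case: ifP.
have A01 x X : 0 <= A x X <= 1 by rewrite /A; case: (_ < _); rewrite ?lexx ?ler01.
have A0 x X : (0 <= (A x X)%:E)%E by rewrite lee_fin; case/andP: (A01 x X).
have risk_le x : x \in s -> (\int[Q]_xi F x (sh x xi) <= W)%E.
  move=> /sK[Kx _]; rewrite -QE.
  - apply: ereal_sup_ubound; exists x, P, id; split=> //.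
    exact: adversary_id.
  - exact: (measurableT_comp (mF x) (msh x)).
  - by move=> xi; rewrite lee_fin sqnorm_ge0.
have mAs x y : measurable_fun setT (fun xi => (A x (sh y xi))%:E).
  exact: (measurableT_comp (mA x) (msh y)).
pose q x y := fine (\int[Q]_xi (A x (sh y xi))%:E).
have qE x y : (\int[Q]_xi (A x (sh y xi))%:E = (q x y)%:E)%E.
  have Ige : (0 <= \int[Q]_xi (A x (sh y xi))%:E)%E.
    by apply: integral_ge0 => xi _; exact: A0.
  rewrite fineK// ge0_fin_numE//.
  apply: (@le_lt_trans _ _ 1%E); last exact: ltry.
  rewrite -(integral_probability_cst Q 1%E); apply: ge0_le_integral => //.
  by move=> xi _; rewrite lee_fin; case/andP: (A01 x (sh y xi)).
have step1 x : x \in s -> ((r ^+ 2)%:E <= W + (r ^+ 2 * q x x)%:E)%E.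
  move=> xs; apply: le_trans (leeD2r _ (risk_le x xs)).
  rewrite [(r ^+ 2 * q x x)%:E]EFinM -qE -ge0_integralZl_EFin ?sqr_ge0//.
  rewrite -ge0_integralD//; last 4 first.
  - by move=> xi _; rewrite lee_fin sqnorm_ge0.
  - exact: (measurableT_comp (mF x) (msh x)).
  - by move=> xi _; rewrite mule_ge0// lee_fin sqr_ge0.
  - exact: measurable_funeM.
  rewrite -[leLHS](integral_probability_cst Q); apply: ge0_le_integral => //.
  - by move=> xi _; rewrite lee_fin sqr_ge0.
  - apply: emeasurable_funD; last exact: measurable_funeM.
    exact: (measurableT_comp (mF x) (msh x)).
  - move=> xi _; rewrite -EFinM -EFinD lee_fin /A; case: ltP => h.
      by rewrite mulr1 lerDr sqnorm_ge0.
    by rewrite mulr0 addr0 -sqr_dist lerXn2r ?nnegrE ?dist_ge0// ltW.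
pose L theta (xi : sample n N) := \prod_(i < N) likelihood tau theta (tnth xi i).
have L_ge0 theta xi : 0 <= L theta xi by apply: prodr_ge0 => i _; exact: likelihood_ge0.
have mL theta : measurable_fun setT (fun xi => L theta xi : mR).
  apply: measurable_prod => i _.
  exact: (measurableT_comp (measurable_likelihood tau theta) (measurable_tnth i)).
have change theta G : measurable_fun setT G -> (forall X, 0 <= G X)%E ->
    (\int[Q]_xi G [tuple vadd theta (tnth xi i) | i < N] =
     \int[Q]_xi (G xi * (L theta xi)%:E))%E.
  move=> mG G0.
  have mGL : measurable_fun setT (fun xi => G xi * (L theta xi)%:E)%E.
    by apply: emeasurable_funM => //; apply/measurable_EFinP; exact: mL.
  have mGs : measurable_fun setT (fun xi => G (sh theta xi)).
    exact: (measurableT_comp mG (msh theta)).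
  rewrite -(QE _ mGs (fun=> G0 _)) -(QE _ mGL); last first.
    by move=> xi; rewrite mule_ge0// lee_fin.
  apply: (@iid_expect_change _ _ P N (fun=> vadd theta) (fun=> likelihood tau theta)) => //.
  - by move=> _; exact: measurable_vadd.
  - by move=> _; exact: measurable_likelihood.
  - by move=> _ x; exact: likelihood_ge0.
  - by move=> _ f mf f0; exact: Pshift.
have int_L theta : (\int[Q]_xi (L theta xi)%:E = 1)%E.
  have := change theta (cst 1%E) (measurable_cst _) (fun=> lee01).
  rewrite integral_probability_cst => ->.
  by apply: eq_integral => xi _; rewrite mul1e.
pose B : RR := expR (N%:R * (delta ^+ 2 / tau ^+ 2)).
have B0 : 0 < B by exact: expR_gt0.
have L2 theta xi : sqnorm theta <= delta ^+ 2 ->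
    L theta xi ^+ 2 <= B * L (vscale 2 theta) xi.
  move=> td; rewrite /L -prodrXl.
  under eq_bigr do rewrite likelihood_sqr//.
  rewrite big_split/= ler_wpM2r//; first by apply: prodr_ge0 => i _; exact: likelihood_ge0.
  rewrite prodr_const card_ord -expRM_natl ler_expR ler_wpM2l//.
  by rewrite ler_wpM2r// invr_ge0 sqr_ge0.
have step2 x : x \in s -> q x x <= 7 / 16 + 4 / 7 * B * q x nu.
  move=> /sK[_ xnu].
  pose theta := vsub x nu.
  have td : sqnorm theta <= delta ^+ 2.
    by rewrite -sqr_dist lerXn2r ?nnegrE ?dist_ge0// ltW.
  pose t := 7 / 8 / B; have t0 : 0 < t by rewrite !divr_gt0.
  have t2 : 0 <= 1 / (2 * t).
    by apply: divr_ge0 => //; apply: mulr_ge0 => //; exact: ltW.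
  have tB : 0 <= t / 2 * B.
    by apply: mulr_ge0; [apply: divr_ge0 => //|]; exact: ltW.
  rewrite -lee_fin -qE.
  have -> : (\int[Q]_xi (A x (sh x xi))%:E =
      \int[Q]_xi ((A x (sh nu xi))%:E * (L theta xi)%:E))%E.
    transitivity (\int[Q]_xi (A x (sh nu [tuple vadd theta (tnth xi i) | i < N]))%:E)%E;
      last exact: (change theta (fun xi => (A x (sh nu xi))%:E) (mAs x nu) (fun xi => A0 x _)).
    apply: eq_integral => xi _; congr (A x _)%:E; apply: eq_from_tnth => i.
    by rewrite !tnth_mktuple; apply: vec_ext => j; rewrite !coordE; ring.
  apply: (@le_trans _ _ (\int[Q]_xi ((t / 2 * B)%:E * (L (vscale 2 theta) xi)%:E +
      (1 / (2 * t))%:E * (A x (sh nu xi))%:E))%E).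
    apply: ge0_le_integral => //.
    - by move=> xi _; rewrite mule_ge0// lee_fin.
    - by apply: emeasurable_funM => //; apply/measurable_EFinP; exact: mL.
    - apply: emeasurable_funD; apply: measurable_funeM => //.
      by apply/measurable_EFinP; exact: mL.
    - move=> xi _; rewrite -!EFinM -EFinD lee_fin.
      have h := L2 theta xi td; have l0 := L_ge0 theta xi.
      apply: (@le_trans _ _ (t / 2 * L theta xi ^+ 2 + 1 / (2 * t) * A x (sh nu xi) ^+ 2)).
        rewrite -subr_ge0 (_ : _ - _ =
          (t * L theta xi - A x (sh nu xi)) ^+ 2 / (2 * t)); last by field; rewrite gt_eqF.
        by rewrite divr_ge0 ?sqr_ge0// mulr_ge0// ltW.
      apply: lerD.
        by rewrite -[leRHS]mulrA ler_wpM2l// divr_ge0// ltW.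
      have A2 : A x (sh nu xi) ^+ 2 <= A x (sh nu xi).
        by have /andP[a0 a1] := A01 x (sh nu xi); rewrite expr2 ler_piMr.
      exact: ler_wpM2l A2.
  rewrite ge0_integralD//; last 4 first.
  - by move=> xi _; rewrite mule_ge0// lee_fin.
  - by apply: measurable_funeM; apply/measurable_EFinP; exact: mL.
  - by move=> xi _; rewrite mule_ge0// lee_fin.
  - exact: measurable_funeM.
  rewrite !ge0_integralZl_EFin//.
  - rewrite int_L qE -!EFinM -EFinD lee_fin mulr1 lerD//.
      by rewrite /t le_eqVlt; apply/orP; left; apply/eqP; field; rewrite gt_eqF.
    by rewrite /t le_eqVlt; apply/orP; left; apply/eqP; field; rewrite gt_eqF.
  - by move=> xi _; rewrite lee_fin.
  - by apply/measurable_EFinP; exact: mL.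
have q0 : \sum_(x <- s) q x nu <= 1.
  rewrite -lee_fin -sumEFin.
  under eq_bigr do rewrite -qE.
  rewrite -ge0_integral_sum//.
  rewrite -(integral_probability_cst Q 1%E); apply: ge0_le_integral => //.
  - by move=> xi _; rewrite sume_ge0.
  - exact: emeasurable_sum.
  - move=> xi _; rewrite sumEFin lee_fin; apply: separated_near_le1 => //.
    by rewrite (_ : r + r = delta / 2)//; rewrite /r; field.
have Bm : B <= 49 / 64 * (size s)%:R.
  apply: sqr_bound_le_sqrt2; [exact: ltW|by rewrite ler_nat|].
  apply: le_trans sB; rewrite -expRM_natl ler_expR le_eqVlt; apply/orP; left; apply/eqP.
  by rewrite /tau; field; rewrite gt_eqF.
have [->|Wy] := eqVneq W +oo%E; first exact: leey.
have Wfin : W \is a fin_num.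
  have [x xs] : exists x, x \in s by case: (s) s2 => // x t; exists x; rewrite inE eqxx.
  rewrite ge0_fin_numE ?ltey//; apply: le_trans (risk_le x xs).
  by apply: integral_ge0 => xi _; rewrite lee_fin sqnorm_ge0.
rewrite -(fineK Wfin) lee_fin in step1 *; move: (fine W) step1 => w step1.
have r2 : 0 < r ^+ 2 by rewrite exprn_gt0.
have m0 : 0 < (size s)%:R :> RR by rewrite ltr0n (leq_trans _ s2).
have sum1 : \sum_(x <- s) r ^+ 2 <= \sum_(x <- s) (w + r ^+ 2 * (7 / 16 + 4 / 7 * B * q x nu)).
  rewrite big_seq [leRHS]big_seq; apply: ler_sum => x xs.
  have := step1 x xs; rewrite -EFinD lee_fin => /le_trans; apply.
  by rewrite lerD2l ler_pM2l//; exact: step2.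
have sum_cst (a : RR) : \sum_(x <- s) a = (size s)%:R * a.
  by rewrite big_const_seq count_predT iter_addr_0 mulr_natl.
have sumE : \sum_(x <- s) (w + r ^+ 2 * (7 / 16 + 4 / 7 * B * q x nu)) =
    (size s)%:R * w + r ^+ 2 * ((size s)%:R * (7 / 16) + 4 / 7 * B * \sum_(x <- s) q x nu).
  rewrite big_split/= sum_cst; congr (_ + _).
  by rewrite -mulr_sumr big_split/= sum_cst -mulr_sumr.
move: sum1; rewrite sumE sum_cst.
exact: packing_arithmetic.
Qed.

End packing_lower_bound.

(** * The minimax rate *)

Section minimax_rate.
Context (n N : nat) (K : set (vec n)) (sigma eps : RR).
Hypothesis s0 : 0 < sigma.

Lemma minimax_ge0 : 0 <= eps -> K !=set0 -> (0 <= minimax_sym N K sigma eps)%E.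
Proof.
move=> e0 [x Kx]; apply: le_ereal_inf_tmp => _ [muhat _ <-].
have [P [PXi _]] : exists P : probability (vec n) RR, Xi_sym sigma P /\ True.
  have [|P [PXi _]] := @lattice_noise_ex n sigma 0 (vzero n) (ltW s0).
    by rewrite expr0n mul0r sqr_ge0.
  by exists P.
apply: (@le_trans _ _ (risk P x id muhat)).
  by apply: iid_expect_ge0 => xi; rewrite lee_fin sqnorm_ge0.
by apply: ereal_sup_ubound; exists x, P, id; split=> //; exact: adversary_id.
Qed.

Lemma minimax_le_radius x (rho : RR) : 0 <= rho ->
  (forall mu, K mu -> dist x mu <= rho) ->
  (minimax_sym N K sigma eps <= (rho ^+ 2)%:E)%E.
Proof.
move=> rho0 Krho; apply: le_trans (_ : worst_risk K sigma eps (fun _ : sample n N => x) <= _)%E.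
  by apply: ereal_inf_lbound; exists (fun=> x) => //; exact: measurable_cst.
apply/ereal_supP => _ [mu [P [C [Kmu _ _ ->]]]].
rewrite /risk iid_expect_cst ?sqnorm_ge0// lee_fin -sqr_dist.
by rewrite lerXn2r ?nnegrE ?dist_ge0// Krho.
Qed.

Lemma diam_le_radius x (rho : RR) :
  (forall y, K y -> dist x y <= rho) -> (diam K <= (rho + rho)%:E)%E.
Proof.
move=> Krho; apply/ereal_supP => _ [y Ky [z Kz <-]]; rewrite lee_fin.
by apply: (le_trans (dist_triangle x _ _)); rewrite lerD ?Krho// dist_sym Krho.
Qed.

Lemma star_point_at ks k (h : RR) : K ks -> K k ->
  (forall k t, K k -> 0 <= t <= 1 -> K (vadd (vscale (1 - t) ks) (vscale t k))) ->
  0 < h -> h <= dist ks k -> exists2 y, K y & dist ks y = h.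
Proof.
move=> Kks Kk star h0 hd; have d0 : 0 < dist ks k by exact: lt_le_trans hd.
pose a := h / dist ks k; have a0 : 0 <= a by rewrite divr_ge0 ?ltW.
exists (vadd (vscale (1 - a) ks) (vscale a k)).
  by apply: star => //; rewrite a0/= ler_pdivrMr// mul1r.
by rewrite dist_sym dist_segment// (dist_sym k) divfK// gt_eqF.
Qed.

Lemma minimax_ge_delta delta : star_shaped K -> 0 <= eps -> (0 < N)%N -> 0 < delta ->
  ((N%:R * delta ^+ 2 / sigma ^+ 2)%:E <= lne (Mloc K delta 2%R))%E ->
  ((delta ^+ 2 / (8 * 24 ^+ 2))%:E <= minimax_sym N K sigma eps)%E.
Proof.
move=> star e0 N0 d0 h.
have [ks Kks _] := star; have Kn0 : K !=set0 by exists ks.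
pose d6 := delta / 6; have d60 : 0 < d6 by rewrite divr_gt0.
set t := N%:R * delta ^+ 2 / sigma ^+ 2 in h.
have t0 : 0 < t by rewrite divr_gt0 ?exprn_gt0// mulr_gt0 ?exprn_gt0// ltr0n.
have M6 : ((expR t)%:E <= Mloc K d6 2%R)%E.
  apply: (@le_trans _ _ (Mloc K delta 2%R)); last first.
    by apply: star_Mloc_nincr => //; rewrite ler_pdivrMr// ler_peMr ?ler1n ?ltW.
  have M0 : (0 <= Mloc K delta 2%R)%E by apply: le_trans (Mloc_ge1 2 Kn0 (ltW d0)).
  by rewrite -(eqP (etrans (lneK_eq _) M0)) -[(expR t)%:E]/(expeR t%:E) lee_expeR.
have : ((expR (t / 2))%:E < Mloc K d6 2%R)%E.
  by apply: lt_le_trans M6; rewrite lte_fin ltr_expR; lra.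
move=> /lt_Mloc_ex[nu [s [Knu us sK sep tsz]]].
have -> : delta ^+ 2 / (8 * 24 ^+ 2) = (d6 / 4) ^+ 2 / 8 by rewrite /d6; field.
apply: (lower_packing s0 e0 d60 sK us sep).
  rewrite -(ltr_nat RR); apply: le_lt_trans tsz.
  by rewrite -[leLHS]expR0 ler_expR divr_ge0// ltW.
apply: le_trans (ltW tsz); rewrite ler_expR le_eqVlt; apply/orP; left; apply/eqP.
by rewrite /t /d6; field; rewrite gt_eqF.
Qed.

Lemma minimax_ge_contamination ks k : (0 < N)%N -> 0 < eps <= 1 -> K ks -> K k ->
  (forall k t, K k -> 0 <= t <= 1 -> K (vadd (vscale (1 - t) ks) (vscale t k))) ->
  ((Num.min (dist ks k) (sigma * eps / 3) ^+ 2 / 8)%:E <= minimax_sym N K sigma eps)%E.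
Proof.
move=> N0 /andP[e0 e1] Kks Kk star; set h := Num.min _ _.
have se0 : 0 < sigma * eps / 3 by rewrite divr_gt0 ?mulr_gt0.
have h0 : 0 <= h by rewrite le_min dist_ge0 ltW.
have [hz|hn] := eqVneq h 0.
  by rewrite hz expr0n mul0r minimax_ge0 ?(ltW e0)//; exists ks.
have hpos : 0 < h by rewrite lt_neqAle eq_sym hn.
have hd : h <= dist ks k by rewrite ge_min lexx.
have [y Ky yE] := star_point_at Kks Kk star hpos hd.
rewrite -yE; apply: lower_contamination => //; rewrite ?yE ?e0//.
by rewrite mulrC -ler_pdivlMr// ge_min lexx orbT.
Qed.

Lemma minimax_le_rate ks (D : RR) : (0 < N)%N -> K ks ->
  (forall k t, K k -> 0 <= t <= 1 -> K (vadd (vscale (1 - t) ks) (vscale t k))) ->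
  0 < eps -> eps <= (2 ^+ 7)^-1 ->
  ((2 ^+ 14)%:E * sup_log_Mloc K 2%R <= N%:R%:E)%E ->
  delta_star K N sigma 2%R = D%:E -> 0 <= D -> D <= sigma / 2 ^+ 7 ->
  (minimax_sym N K sigma eps <= (2 ^+ 51 * Num.max (D ^+ 2) (eps ^+ 2 * sigma ^+ 2))%:E)%E.
Proof.
move=> N0 Kks star e0 e7 HC DE D0 Ds.
have starK : star_shaped K by exists ks.
pose eta := 2 * Num.max D (eps * sigma).
have es0 : 0 < eps * sigma by rewrite mulr_gt0.
have m0 : 0 < Num.max D (eps * sigma) by rewrite lt_max es0 orbT.
have eta0 : 0 < eta by rewrite mulr_gt0.
have etaD : D < eta.
  have : D <= Num.max D (eps * sigma) by rewrite le_max lexx.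
  by rewrite /eta; lra.
have eta2 : eta ^+ 2 = 4 * Num.max (D ^+ 2) (eps ^+ 2 * sigma ^+ 2).
  rewrite exprMn (_ : 2 ^+ 2 = 4 :> RR); last by ring.
  congr (_ * _); rewrite -exprMn; case: (leP D (eps * sigma)) => h.
    by rewrite max_r// lerXn2r ?nnegrE// ltW.
  by rewrite max_l// lerXn2r ?nnegrE ?(ltW es0) ?(ltW h).
have two k : 0 < 2 ^+ k :> RR by rewrite exprn_gt0.
have pow49 : 2 ^+ 49 * eta ^+ 2 = 2 ^+ 51 * Num.max (D ^+ 2) (eps ^+ 2 * sigma ^+ 2).
  by rewrite eta2; ring.
rewrite -pow49.
have [[k Kk kd]|far] := pselect (exists2 k, K k & eta <= dist ks k); last first.
  apply: (@le_trans _ _ (eta ^+ 2)%:E); last first.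
    by rewrite lee_fin ler_peMl ?sqr_ge0// exprn_ege1// ler1n.
  apply: (minimax_le_radius (x := ks) (ltW eta0)) => mu Kmu.
  by rewrite leNgt; apply/negP => h; apply: far; exists mu => //; exact: ltW.
have [y Ky yE] := star_point_at Kks Kk star eta0 kd.
have M2 : (2%:R%:E <= Mloc K eta 2%R)%E.
  by apply: (Mloc_ge2 (x := ks) (y := y)) => //; rewrite ltr1n.
have M0 : (0 <= Mloc K eta 2%R)%E by apply: le_trans M2; rewrite lee_fin.
have ln2 : 1 / 2 <= ln 2 :> RR.
  rewrite -[leLHS](expRK (1 / 2)) ler_ln ?posrE ?expR_gt0//.
  by apply: (le_trans (@expR_le_quad _ _)); rewrite ?expr2; lra.
have lnM : ((ln 2)%:E <= lne (Mloc K eta 2%R))%E.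
  by rewrite -lne_EFin// lee_lne// in_itv/= ?leey ?andbT// lee_fin.
have N12 : 2 ^+ 12 <= N%:R :> RR.
  rewrite -lee_fin; apply: le_trans HC.
  apply: (@le_trans _ _ ((2 ^+ 14)%:E * (ln 2)%:E)%E).
    rewrite -EFinM lee_fin (_ : 2 ^+ 14 = 2 ^+ 12 * 4); last by ring.
    by rewrite -mulrA ler_peMr ?exprn_ge0//; lra.
  rewrite lee_wpmul2l ?lee_fin ?exprn_ge0//; apply: le_trans lnM _.
  by apply: ereal_sup_ubound; exists eta.
have wE (x : RR) : N%:R * x ^+ 2 / sigma ^+ 2 = N%:R * (x / sigma) ^+ 2.
  by field; rewrite gt_eqF.
have Nlt : (lne (Mloc K eta 2%R) < (N%:R * (eta / sigma) ^+ 2)%:E)%E.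
  rewrite ltNge -wE; apply/negP => h.
  have : (eta%:E <= delta_star K N sigma 2%R)%E.
    by apply: ereal_sup_ubound; exists eta => //; split=> //; exact: ltW.
  by rewrite DE lee_fin leNgt etaD.
have Mle : (Mloc K eta 2%R <= (expR (N%:R * (eta / sigma) ^+ 2))%:E)%E.
  rewrite -(eqP (etrans (lneK_eq _) M0)) -[(expR _)%:E]/(expeR (_)%:E) lee_expeR.
  exact: ltW.
apply: upper_risk => //.
- rewrite (ltW e0)/=; apply: (le_trans e7).
  by rewrite div1r lef_pV2 ?posrE//; rewrite !exprS expr0; lra.
- have : eps * sigma <= Num.max D (eps * sigma) by rewrite le_max lexx orbT.
  by rewrite /eta; lra.
- have -> : (2 ^+ 12)^-1 = ((2 ^+ 6)^-1) ^+ 2 :> RR by rewrite exprVn -exprM.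
  apply: lerXn2r; rewrite ?nnegrE ?invr_ge0 ?divr_ge0 ?(ltW eta0) ?(ltW s0) ?(ltW (two 6))//.
  rewrite ler_pdivrMr// /eta.
  have -> : (2 ^+ 6)^-1 * sigma = 2 * ((2 ^+ 7)^-1 * sigma) by field.
  rewrite ler_pM2l// ge_max; apply/andP; split; first by rewrite mulrC.
  by rewrite ler_pM2r.
- apply: le_trans ln2 _; rewrite -lee_fin; apply: le_trans lnM _; exact: ltW.
- by exists ks.
- move=> eta' nu s ee' Knu us sK sep; rewrite -lee_fin; apply: le_trans Mle.
  apply: (@le_trans _ _ (Mloc K eta' 2%R)); first exact: (le_Mloc Knu us sK sep).
  exact: star_Mloc_nincr.
Qed.

Lemma delta_star_fin : (0 < N)%N -> K !=set0 ->
  ((2 ^+ 14)%:E * sup_log_Mloc K 2%R <= N%:R%:E)%E ->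
  exists D : RR, [/\ delta_star K N sigma 2%R = D%:E, 0 <= D & D <= sigma / 2 ^+ 7].
Proof.
move=> N0 Kn0 HC.
have ge0 : (0%:E <= delta_star K N sigma 2%R)%E.
  apply: ereal_sup_ubound; exists 0 => //; split=> //.
  rewrite expr0n mulr0 mul0r lne_ge0; exact: Mloc_ge1.
have le7 : (delta_star K N sigma 2%R <= (sigma / 2 ^+ 7)%:E)%E.
  apply/ereal_supP => _ [delta [d0 h] <-]; rewrite lee_fin.
  have [->|dn] := eqVneq delta 0; first by rewrite divr_ge0 ?ltW// exprn_gt0.
  have dpos : 0 < delta by rewrite lt_neqAle eq_sym dn.
  have : ((2 ^+ 14 * (N%:R * delta ^+ 2 / sigma ^+ 2))%:E <= N%:R%:E)%E.
    apply: le_trans HC; rewrite EFinM lee_wpmul2l ?lee_fin ?exprn_ge0//.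
    by apply: le_trans h _; apply: ereal_sup_ubound; exists delta.
  rewrite lee_fin.
  have Npos : 0 < N%:R :> RR by rewrite ltr0n.
  have -> : 2 ^+ 14 * (N%:R * delta ^+ 2 / sigma ^+ 2) =
      N%:R * ((2 ^+ 7 * delta / sigma) ^+ 2) by field; rewrite gt_eqF.
  have p7 : 0 < 2 ^+ 7 :> RR by rewrite exprn_gt0.
  rewrite -[leRHS]mulr1 ler_pM2l// -[X in _ <= X](expr1n _ 2).
  rewrite ler_pXn2r ?nnegrE ?divr_ge0 ?mulr_ge0 ?(ltW p7) ?(ltW s0)//.
  by rewrite ler_pdivrMr// mul1r mulrC -ler_pdivlMr.
have : delta_star K N sigma 2%R \is a fin_num.
  by rewrite ge0_fin_numE//; exact: le_lt_trans le7 (ltry _).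
move=> /fineK fE; exists (fine (delta_star K N sigma 2%R)).
by rewrite -lee_fin fE -lee_fin fE.
Qed.

End minimax_rate.

Theorem mainTheorem3 :
  exists (c Q C0 clo chi : RR),
    [/\ 0 < c, 0 < Q, 0 < C0, 0 < clo & 0 < chi] /\
    forall (n N : nat) (K : set (vec n)) (sigma eps : RR),
      (0 < n)%N -> (0 < N)%N ->
      star_shaped K -> 0 < sigma -> 0 < eps < Q^-1 ->
      (C0%:E * sup_log_Mloc K c <= N%:R%:E)%E ->
      let ds := delta_star K N sigma c in
      let rate := Order.max (ds * ds)%E ((eps ^+ 2 * sigma ^+ 2)%:E) in
      let M := minimax_sym N K sigma eps in
      ((diam K < +oo)%E ->
         (clo%:E * Order.min rate (diam K * diam K) <= M)%E /\
         (M <= chi%:E * Order.min rate (diam K * diam K))%E) /\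
      (diam K = +oo%E ->
         (clo%:E * rate <= M)%E /\ (M <= chi%:E * rate)%E).
Proof.
exists 2, (2 ^+ 7), (2 ^+ 14), (2 ^+ 15)^-1, (2 ^+ 51); split.
  by split; rewrite ?invr_gt0 ?exprn_gt0.
move=> n N K sigma eps _ N0 starK s0 /andP[e0 e7] HC ds rate M.
have [ks Kks star] := starK; have Kn0 : K !=set0 by exists ks.
have [D [DE D0 D7]] := delta_star_fin s0 N0 Kn0 HC.
have two k : 0 < 2 ^+ k :> RR by rewrite exprn_gt0.
have e1 : 0 < eps <= 1.
  by rewrite e0/=; apply: (le_trans (ltW e7)); rewrite invf_le1// exprn_ege1// ler1n.
have up := minimax_le_rate s0 N0 Kks star e0 (ltW e7) HC DE D0 D7.
rewrite -/M in up.
have M0 : (0 <= M)%E by apply: minimax_ge0 => //; exact: ltW.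
have Mfin : M \is a fin_num by rewrite ge0_fin_numE//; exact: le_lt_trans up (ltry _).
have loD : ((D ^+ 2 / 2 ^+ 15)%:E <= M)%E.
  have [->|Dn] := eqVneq D 0; first by rewrite expr0n mul0r.
  have Dpos : 0 < D by rewrite lt_neqAle eq_sym Dn.
  have : ((D / 2)%:E < delta_star K N sigma 2%R)%E by rewrite DE lte_fin; lra.
  move=> /ereal_sup_gt[_ [delta [d0 h] <-]]; rewrite lte_fin => Dd.
  have dpos : 0 < delta by lra.
  apply: le_trans (minimax_ge_delta s0 starK (ltW e0) N0 dpos h).
  rewrite lee_fin; apply: (@le_trans _ _ ((D / 2) ^+ 2 / (8 * 24 ^+ 2))).
    have -> : (D / 2) ^+ 2 / (8 * 24 ^+ 2) = D ^+ 2 * (4 * (8 * 24 ^+ 2))^-1 by field.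
    rewrite ler_wpM2l ?sqr_ge0// lef_pV2 ?posrE ?mulr_gt0 ?exprn_gt0//.
    by rewrite -subr_ge0; have -> : 2 ^+ 15 - 4 * (8 * 24 ^+ 2) = 14 * 2 ^+ 10 :> RR by ring.
  rewrite ler_pM2r ?invr_gt0 ?mulr_gt0 ?exprn_gt0//.
  by rewrite lerXn2r ?nnegrE ?divr_ge0// ltW.
have radius rho : 0 <= rho -> (forall mu, K mu -> dist ks mu <= rho) -> (M <= (rho ^+ 2)%:E)%E.
  exact: minimax_le_radius.
have loE k : K k -> ((Num.min (dist ks k) (sigma * eps / 3) ^+ 2 / 8)%:E <= M)%E.
  by move=> Kk; apply: minimax_ge_contamination.
pose E := eps ^+ 2 * sigma ^+ 2.
have rateE : rate = (Num.max (D ^+ 2) E)%:E.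
  by rewrite /rate /ds DE -EFinM -expr2 -EFin_max.
rewrite rateE; move: M0 up loD loE radius Mfin; rewrite -/E.
case: M => [m| |]// m0 up loD loE radius _.
rewrite !lee_fin in m0 up loD.
have se0 : 0 < sigma * eps by case/andP: e1 => ? _; rewrite mulr_gt0.
have E_ge0 : 0 <= E by rewrite mulr_ge0 ?sqr_ge0.
have pow15 : 2 ^+ 7 <= 2 ^+ 15 :> RR by rewrite ler_weXn2l ?ler1n.
have lo_sqr k a : K k -> 0 <= a -> a <= dist ks k -> a <= sigma * eps / 3 ->
    a ^+ 2 / 8 <= m.
  move=> Kk a0 ad ae; have := loE k Kk; rewrite lee_fin; apply: le_trans.
  rewrite ler_pM2r ?invr_gt0// lerXn2r ?nnegrE// ?le_min ?ad ?ae//.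
  by rewrite dist_ge0 divr_ge0 ?(ltW se0).
split=> [dfin|dinf].
  have [d dE d0] : exists2 d : RR, diam K = d%:E & 0 <= d.
    have ge0 : (0%:E <= diam K)%E.
      by apply: ereal_sup_ubound; exists ks => //; exists ks => //; rewrite distxx.
    exists (fine (diam K)); first by rewrite fineK// ge0_fin_numE.
    by rewrite -lee_fin fineK// ge0_fin_numE.
  have diam_ge x y : K x -> K y -> dist x y <= d.
    move=> Kx Ky; rewrite -lee_fin -dE.
    by apply: ereal_sup_ubound; exists x => //; exists y.
  rewrite dE -!EFinM -expr2 -EFin_min -!EFinM !lee_fin; split; last first.
    case: (leP (Num.max (D ^+ 2) E) (d ^+ 2)) => [h|/ltW h]; first exact: up.
    apply: (@le_trans _ _ (d ^+ 2)).
      by rewrite -lee_fin; apply: radius => // mu; exact: diam_ge.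
    by rewrite ler_peMl ?sqr_ge0// exprn_ege1// ler1n.
  have loEd : Num.min E (d ^+ 2) <= 2 ^+ 7 * m.
    have [dz|dn] := eqVneq d 0.
      apply: (@le_trans _ _ 0); last by rewrite mulr_ge0// ltW.
      by rewrite ge_min dz expr0n lexx orbT.
    have dpos : 0 < d by rewrite lt_neqAle eq_sym dn.
    have [k Kk dk] : exists2 k, K k & d / 4 <= dist ks k.
      apply: contrapT => far; have : (diam K <= (d / 4 + d / 4)%:E)%E.
        apply: (diam_le_radius (x := ks)) => y Ky; rewrite leNgt; apply/negP => h.
        by apply: far; exists y => //; exact: (ltW h).
      by rewrite dE lee_fin; lra.
    pose a := Num.min (sigma * eps) d / 4.
    have a0 : 0 <= a by rewrite divr_ge0// le_min d0 (ltW se0).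
    have am : a ^+ 2 / 8 <= m.
      apply: (lo_sqr k) => //.
        by apply: le_trans dk; rewrite ler_pM2r ?invr_gt0// ge_min lexx orbT.
      have : Num.min (sigma * eps) d <= sigma * eps by rewrite ge_min lexx.
      by rewrite /a; lra.
    have -> : Num.min E (d ^+ 2) = (4 * a) ^+ 2.
      rewrite /a mulrC divfK// /E mulrC -exprMn.
      case: (leP (sigma * eps) d) => [h|/ltW h].
        by rewrite min_l// lerXn2r ?nnegrE ?(ltW se0).
      by rewrite min_r// lerXn2r ?nnegrE ?(ltW se0).
    have -> : (4 * a) ^+ 2 = 2 ^+ 7 * (a ^+ 2 / 8) by field.
    by rewrite ler_pM2l.
  rewrite mulrC ler_pdivrMr// [m * _]mulrC.
  case: (leP (D ^+ 2) E) => [h|/ltW h].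
    apply: (le_trans loEd); rewrite ler_wpM2r//.
  apply: (@le_trans _ _ (D ^+ 2)); first by rewrite ge_min lexx.
  by rewrite mulrC -ler_pdivrMr.
rewrite -!EFinM !lee_fin; split=> //.
have [k Kk dk] : exists2 k, K k & sigma * eps / 3 <= dist ks k.
  apply: contrapT => far.
  have : (diam K <= (sigma * eps / 3 + sigma * eps / 3)%:E)%E.
    apply: (diam_le_radius (x := ks)) => y Ky; rewrite leNgt; apply/negP => h.
    by apply: far; exists y => //; exact: (ltW h).
  by rewrite dinf leye_eq.
have Em : E <= 2 ^+ 7 * m.
  have := lo_sqr k (sigma * eps / 3) Kk _ dk (lexx _).
  have -> : (sigma * eps / 3) ^+ 2 / 8 = E / (72) by rewrite /E; field.
  rewrite divr_ge0 ?(ltW se0)// => /(_ isT); rewrite ler_pdivrMr// => /le_trans; apply.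
  rewrite mulrC ler_wpM2r//.
  by rewrite -subr_ge0; have -> : 2 ^+ 7 - 72 = 7 * 2 ^+ 3 :> RR by ring.
rewrite mulrC ler_pdivrMr// [m * _]mulrC.
case: (leP (D ^+ 2) E) => [h|/ltW h].
  by apply: (le_trans Em); rewrite ler_wpM2r.
by rewrite mulrC -ler_pdivrMr.
Qed.
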